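(* Let $\mathfrak n=\mathfrak v\oplus\mathfrak z$ be an H-type Lie algebra with group $N$, let $\mathfrak n_1=\mathfrak v_1\oplus\mathfrak z$ be an H-type subalgebra with $\mathfrak v=\mathfrak v_1\oplus\mathfrak v_2$, and let $D_{s,k}$ ($k\in\mathbb N_0$) be the left-invariant differential operators on $N$, depending rationally on $s\in\mathbb C$, defined recursively in the context. Then for every $k\ge 0$ and every $s\in\mathbb C$ for which $D_{s,k}$ is defined: (a) $D_{s,k}$ is of the form $$D_{s,k}=\sum_{i+j+2\ell=k}C_{s,k}(i,j,\ell)\,\Delta_1^i\Delta_2^j\Box^\ell$$ with constants $C_{s,k}(i,j,\ell)\in\mathbb C$ (the sum being over integers $i,j,\ell\ge 0$); (b) $D_{s,k}K_s=|X_2|^{2k}K_{s-k}$ as functions of $(X,Z)$ on $N\setminus\{0\}$, where $X=X_1+X_2$ with $X_i\in\mathfrak v_i$.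
   Context: H-type algebras and groups. Let $\mathfrak n$ be a finite-dimensional real Lie algebra with inner product $\langle\cdot,\cdot\rangle$ (norm $|\cdot|$) and orthogonal decomposition $\mathfrak n=\mathfrak v\oplus\mathfrak z$ with $[\mathfrak v,\mathfrak v]=\mathfrak z$, $[\mathfrak v,\mathfrak z]=0$ (and $\mathfrak z$ central). For $Z\in\mathfrak z$ define $J_Z:\mathfrak v\to\mathfrak v$ by $\langle J_ZX,Y\rangle=\langle Z,[X,Y]\rangle$. $\mathfrak n$ is called of H-type if $J_Z^2=-16|Z|^2\,\mathrm{id}$ for all $Z\in\mathfrak z$ (note the factor 16). The abelian case $\mathfrak z=0$ is allowed. Put $p=\dim\mathfrak v$, $q=\dim\mathfrak z$, $\rho=\frac{p+2q}{2}$. The group $N$ is $\mathfrak n$ with product $(X,Z)\cdot(Y,W)=(X+Y,Z+W+\frac12[X,Y])$. H-type subalgebra. $\mathfrak v=\mathfrak v_1\oplus\mathfrak v_2$ is an orthogonal decomposition with $[\mathfrak v_1,\mathfrak v_2]=0$ and $[\mathfrak v_1,\mathfrak v_1]=\mathfrak z$; $\mathfrak n_1=\mathfrak v_1\oplus\mathfrak z$. Put $p_i=\dim\mathfrak v_i$, $\rho_1=\frac{p_1+2q}{2}$. Differential operators. Each $S\in\mathfrak n$ acts as a left-invariant vector field $(Sf)(n)=\frac{d}{dt}f(n\exp(tS))|_{t=0}$; i.e. $Sf=\partial_Sf-\frac12\partial_{[S,X]}f$ at $(X,Z)$ for $S\in\mathfrak v$, and $Tf=\partial_Tf$ for $T\in\mathfrak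 z$. For orthonormal bases $(S_j)_{j\le p_1}$ of $\mathfrak v_1$, $(S_j)_{p_1<j\le p}$ of $\mathfrak v_2$, $(T_j)$ of $\mathfrak z$: $\Delta_1=\sum_{j\le p_1}S_j^2$, $\Delta_2=\sum_{j>p_1}S_j^2$, $\Delta=\Delta_1+\Delta_2$, $\Box=\sum_jT_j^2$. Norm function: $K(X,Z)=|X|^4+|Z|^2$, $K_s=K^s$ for $s\in\mathbb C$. The operators $D_{s,k}$. With $B(s)=4s(4s+2\rho-2)$, set $D_{s,0}=1$, $$D_{s,1}=\frac{1}{8s(4s+2\rho-2)(2s+q-1)}\big((4s+2\rho-2)\Delta_2-p_2\Delta\big),$$ and for $k\ge1$ $$D_{s,k+1}=\frac{1}{8(s-k)(4s+2\rho-2)(2s+q-2k-1)}\Big[\big((4s+2\rho-2)\Delta_2-(4k+p_2)\Delta\big)D_{s,k}-\frac{2k(2k+p_2-2)(4s+2\rho_1-4k-2)}{2B(s)(2s+q-1)(4s+2\rho-4)}\big(\Delta^2+4(4s+2\rho-2)^2\Box\big)D_{s-1,k-1}\Big].$$ This is read as a recursion of rational functions of $s$ with values in left-invariant differential operators; $D_{s,k}$ is defined at $s$ if $s$ is not a pole. *)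

(* Defs.v *)
From HB Require Import structures.
From mathcomp Require Import all_boot all_order all_algebra.
From mathcomp Require Import complex.
From mathcomp Require Import all_classical all_reals all_analysis.

Set Implicit Arguments.
Unset Strict Implicit.
Unset Printing Implicit Defensive.

Import Order.TTheory GRing.Theory Num.Theory.
Import numFieldNormedType.Exports.

Local Open Scope classical_set_scope.
Local Open Scope complex_scope.
Local Open Scope ring_scope.

Section LieAlgebras.
Context {R : realType} {n : vectType R}.
Implicit Types (br : n -> n -> n) (ip : n -> n -> R) (U V v z : {vspace n}).

Definition lie_bracket br : Prop :=
  [/\ forall x, linear (br x),
      forall y, linear (br^~ y),
      forall x, br x x = 0 &
      forall x y w, br x (br y w) + br y (br w x) + br w (br x y) = 0].

Definition inner_product ip : Prop :=
  [/\ forall x, scalar (ip x),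
      forall x y, ip x y = ip y x &
      forall x, x != 0 -> 0 < ip x x].

Definition ip_norm ip (x : n) : R := Num.sqrt (ip x x).

Definition orthogonal_spaces ip U V : Prop :=
  forall x y, x \in U -> y \in V -> ip x y = 0.

(* [U, V]: by bilinearity the span of brackets of basis vectors is the span of
   all the brackets. *)
Definition bracket_space br U V : {vspace n} :=
  <<[seq br x y | x <- vbasis U, y <- vbasis V]>>%VS.

Definition orthonormal_basis ip U (S : seq n) : Prop :=
  basis_of U S /\
  forall i j, (i < size S)%N -> (j < size S)%N ->
    ip (nth 0 S i) (nth 0 S j) = (i == j)%:R.

(* J Z X is only relevant for Z in z and X in v, where it is uniquely
   determined since ip is nondegenerate on v. *)
Definition is_J br ip v z (J : n -> n -> n) : Prop :=
  forall Z X, Z \in z -> X \in v ->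
    J Z X \in v /\ forall Y, Y \in v -> ip (J Z X) Y = ip Z (br X Y).

End LieAlgebras.

Record htypeAlg (R : realType) := HTypeAlg {
  ht_sort :> vectType R;
  ht_br : ht_sort -> ht_sort -> ht_sort;
  ht_ip : ht_sort -> ht_sort -> R;
  ht_v : {vspace ht_sort};
  ht_z : {vspace ht_sort};
  ht_brP : lie_bracket ht_br;
  ht_ipP : inner_product ht_ip;
  ht_full : (ht_v + ht_z)%VS = fullv;
  ht_orth : orthogonal_spaces ht_ip ht_v ht_z;
  ht_vv : bracket_space ht_br ht_v ht_v = ht_z;
  ht_vz : bracket_space ht_br ht_v ht_z = 0%VS;
  ht_central : bracket_space ht_br ht_z fullv = 0%VS;
  ht_J : exists2 J, is_J ht_br ht_ip ht_v ht_z J &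
    forall Z X, Z \in ht_z -> X \in ht_v ->
      J Z (J Z X) = (- 16 * ip_norm ht_ip Z ^+ 2) *: X }.

Definition htype_subalgebra (R : realType) (n : htypeAlg R)
    (v1 v2 : {vspace n}) : Prop :=
  [/\ (v1 + v2)%VS = ht_v n,
      orthogonal_spaces (@ht_ip R n) v1 v2,
      bracket_space (@ht_br R n) v1 v2 = 0%VS &
      bracket_space (@ht_br R n) v1 v1 = ht_z n].

Section Operators.
Context {R : realType} {n : htypeAlg R}.

(* The group N is n with this product; as z is central and n = v + z, it is
   (X, Z) (Y, W) = (X + Y, Z + W + [X, Y] / 2), and exp is the identity map. *)
Definition group_mul (x y : n) : n := x + y + 2^-1 *: ht_br x y.

Definition cderive1 (g : R -> R[i]) (t : R) : R[i] :=
  derive1 (fun u => complex.Re (g u)) t +i* derive1 (fun u => complex.Im (g u)) t.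

Definition oper : Type := (n -> R[i]) -> n -> R[i].

Definition vfield (S : n) : oper :=
  fun f x => cderive1 (fun t => f (group_mul x (t *: S))) 0.

Definition oper_id : oper := fun f => f.
Definition oper_add (A B : oper) : oper := fun f x => A f x + B f x.
Definition oper_scale (c : R[i]) (A : oper) : oper := fun f x => c * A f x.
Definition oper_comp (A B : oper) : oper := fun f => A (B f).
Definition oper_exp (A : oper) (m : nat) : oper := iter m (oper_comp A) oper_id.

Definition sum_squares (S : seq n) : oper :=
  fun f x => \sum_(T <- S) vfield T (vfield T f) x.

Inductive left_invariant_diffop : oper -> Prop :=
| lido_id : left_invariant_diffop oper_id
| lido_vfield S : left_invariant_diffop (vfield S)
| lido_add A B : left_invariant_diffop A -> left_invariant_diffop B ->
    left_invariant_diffop (oper_add A B)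
| lido_scale c A : left_invariant_diffop A ->
    left_invariant_diffop (oper_scale c A)
| lido_comp A B : left_invariant_diffop A -> left_invariant_diffop B ->
    left_invariant_diffop (oper_comp A B).

(* Topology and smooth structure of n come from linear coordinates. *)
Definition of_coord (a : 'rV[R]_(\dim {:n})) : n :=
  \sum_i a 0 i *: (vbasis {:n})`_i.

Definition open_in (U : set n) : Prop := open (of_coord @^-1` U).

(* C^oo on U: all the iterated directional derivatives are differentiable. *)
Definition smooth_real (U : set n) (g : n -> R) : Prop :=
  forall (vs : seq 'rV[R]_(\dim {:n})) (a : 'rV[R]_(\dim {:n})),
    U (of_coord a) ->
    differentiable
      (foldr (fun w (h : 'rV[R]_(\dim {:n}) -> R) => 'D_w h)
         (fun b => g (of_coord b)) vs) a.

Definition smooth_on (U : set n) (f : n -> R[i]) : Prop :=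
  smooth_real U (fun x => complex.Re (f x)) /\
  smooth_real U (fun x => complex.Im (f x)).

(* Elements of oper are defined on all functions, with junk values on
   nonsmooth ones: equality of differential operators is equality on smooth
   functions on open sets. *)
Definition oper_eq (A B : oper) : Prop :=
  forall (U : set n) (f : n -> R[i]), open_in U -> smooth_on U f ->
    forall x, U x -> A f x = B f x.

(* The polynomial \sum_i s ^ i P_i with coefficients in oper. *)
Definition oper_poly (P : seq oper) (s : R[i]) : oper :=
  fun f x => \sum_(i < size P) s ^+ i * nth oper_id P i f x.

(* F represents a rational function of s with values in the left-invariant
   differential operators, in that only its values outside some finite set
   matter. The following says that s0 is not a pole of this rational function
   and that L is its value at s0: the function is equal to some P / d, with P
   and d polynomial and d(s0) <> 0, and L = P(s0) / d(s0). *)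
Definition regular_value (F : R[i] -> oper) (s0 : R[i]) (L : oper) : Prop :=
  exists (d : {poly R[i]}) (P : seq oper) (E : seq R[i]),
    [/\ d.[s0] != 0,
        forall i, (i < size P)%N -> left_invariant_diffop (nth oper_id P i),
        forall s, s \notin E ->
          oper_eq (oper_scale d.[s] (F s)) (oper_poly P s) &
        oper_eq L (oper_scale d.[s0]^-1 (oper_poly P s0))].

(* Evaluation at s of the recursion for D_{s,k}; it agrees with the rational
   function D_{.,k} away from the finitely many zeros of the denominators
   (where x / 0 = 0 yields irrelevant values). *)
Fixpoint Dop (Delta1 Delta2 Box : oper) (p1 p2 q : nat) (k : nat) (s : R[i])
    {struct k} : oper :=
  let rho : R[i] := (p1 + p2 + 2 * q)%:R / 2 in
  let rho1 : R[i] := (p1 + 2 * q)%:R / 2 in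
  let Delta := oper_add Delta1 Delta2 in
  let B : R[i] := 4 * s * (4 * s + 2 * rho - 2) in
  match k with
  | 0 => oper_id
  | 1 =>
      oper_scale
        (1 / (8 * s * (4 * s + 2 * rho - 2) * (2 * s + q%:R - 1)))
        (oper_add (oper_scale (4 * s + 2 * rho - 2) Delta2)
                  (oper_scale (- p2%:R) Delta))
  | (k''.+1 as k').+1 =>
      let kc : R[i] := k'%:R in
      oper_scale
        (1 / (8 * (s - kc) * (4 * s + 2 * rho - 2)
                * (2 * s + q%:R - 2 * kc - 1)))
        (oper_add
          (oper_comp
            (oper_add (oper_scale (4 * s + 2 * rho - 2) Delta2)
                      (oper_scale (- (4 * kc + p2%:R)) Delta))
            (Dop Delta1 Delta2 Box p1 p2 q k' s))
          (oper_scale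
            (- ((2 * kc * (2 * kc + p2%:R - 2)
                   * (4 * s + 2 * rho1 - 4 * kc - 2))
                / (2 * B * (2 * s + q%:R - 1) * (4 * s + 2 * rho - 4))))
            (oper_comp
              (oper_add (oper_exp Delta 2)
                 (oper_scale (4 * (4 * s + 2 * rho - 2) ^+ 2) Box))
              (Dop Delta1 Delta2 Box p1 p2 q k'' (s - 1)))))
  end.

(* r ^ s = exp (s log r), for r > 0. *)
Definition cpow (r : R) (s : R[i]) : R[i] :=
  let e := expR (complex.Re s * ln r) in
  let t := complex.Im s * ln r in
  (e * cos t) +i* (e * sin t).

Definition Kfun (x : n) : R :=
  ip_norm (@ht_ip R n) (daddv_pi (ht_v n) (ht_z n) x) ^+ 4
  + ip_norm (@ht_ip R n) (daddv_pi (ht_z n) (ht_v n) x) ^+ 2.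

Definition Kpow (s : R[i]) : n -> R[i] := fun x => cpow (Kfun x) s.

(* The component in v2 of an element of n = v1 + v2 + z. *)
Definition proj2 (v1 v2 : {vspace n}) (x : n) : n :=
  daddv_pi v2 (v1 + ht_z n) x.

End Operators.

Arguments oper {R} n.

(* Main.v *)
Require Import Defs.
From HB Require Import structures.
From mathcomp Require Import all_boot all_order all_algebra.
From mathcomp Require Import complex qpoly ring.
From mathcomp Require Import all_classical all_reals all_analysis.

(** On functions of a = |X_1|^2, b = |X_2|^2 and c = |Z|^2, the H-type condition
    makes Delta_1, Delta_2 and Box act as explicit second-order operators.
    Writing M = 4s + 2rho - 2, this gives Delta K_s = 4sM |X|^2 K_{s-1} and
    (Delta^2 + 4M^2 Box) K_s = 8sM (2s+q-1) (4s+2rho-4) K_{s-1}.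
    Delta_1, Delta_2 and Box commute on smooth functions, because [v_1, v_2] = 0
    and z is central.  This gives the form (a), and lets the second term of the
    recursion be evaluated as D_{s-1,k-1} (Delta^2 + 4M^2 Box) K_s, so that (b)
    follows by induction on k when s avoids the zeros of all the denominators.

    At an arbitrary regular s_0 the value is P(s_0) / d(s_0), with P / d equal to
    D_{.,k} outside a finite set.  For (a), Lagrange interpolation writes P(s_0)
    as a combination of values P(s_i) = d(s_i) D_{s_i,k} at good points.  For (b),
    a left-invariant operator sends K_s to K_s times a polynomial in s, so both
    sides of d(s) |X_2|^{2k} K_{s-k} = P(s) K_s become, at each point, K_s times
    polynomials in s which agree at all but finitely many s. *)

Set Implicit Arguments.
Unset Strict Implicit.
Unset Printing Implicit Defensive.

Import Order.TTheory GRing.Theory Num.Theory.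
Import numFieldNormedType.Exports.

Local Open Scope classical_set_scope.
Local Open Scope complex_scope.
Local Open Scope ring_scope.

(** * Smooth real functions *)

(** The H-type condition enters through one identity: over an orthonormal basis of v_1, the sum of
    <Z,[X,S]>^2 is |J_Z X_1|^2 = 16|Z|^2|X_1|^2. It makes the carre du champ of K for Delta_1 equal
    to 16|X_1|^2 K, a multiple of K itself. The factor 16 is matched to K in this sense, and this is
    why Delta_1 K_s needs no power below K_{s-1}. The computations for Delta_1 are made for an
    ordered pair (W, W') and used again for Delta_2 with v_1 and v_2 exchanged. The elements of
    [oper] act on arbitrary functions, with junk values on nonsmooth ones, so linearity, locality
    and commutation are not formal. They are facts about smooth functions on open sets. The first
    two follow by induction over [left_invariant_diffop]; commutation rests on the symmetry of
    second derivatives. For the same reason smoothness has to be carried along everywhere, and K_s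
    has it only away from 0. The recursion is designed for cancellation: its first bracket removes
    the |X|^2 |X_2|^{2k} K_{s-k-1} term, and its second term removes the |X_2|^{2k-2} K_{s-k} term
    left over. *)

Section SmoothFunctions.
Context {R : realType} {V : normedModType R}.
Implicit Types (U : set V) (g h : V -> R).

Definition iter_derive (vs : seq V) g : V -> R :=
  foldr (fun w h => 'D_w h) g vs.

(** Phrased so that [smooth_real], read in the coordinate chart, is convertible to it. *)
Definition smooth U g : Prop :=
  forall vs a, U a -> differentiable (iter_derive vs g) a.

Lemma near_in_open U a : open U -> a \in U -> \forall b \near a, b \in U.
Proof.
rewrite in_setE => oU Ua.
have : \forall b \near a, U b by exact: open_nbhs_nbhs.
by apply: filterS => b; rewrite in_setE.
Qed.

Lemma derive_eq_on U g h w : open U -> {in U, g =1 h} ->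
  {in U, 'D_w g =1 'D_w h}.
Proof.
move=> oU gh a aU; apply: near_eq_derive.
by apply: filterS (near_in_open oU aU) => b /gh.
Qed.

(** The first-order expansion of [g] at [a] also serves for [h], and uniqueness of the differential
    then identifies ['d h a] with ['d g a]. *)
Lemma near_eq_differentiable g h a : (\forall b \near a, g b = h b) ->
  differentiable g a -> differentiable h a.
Proof.
move=> gh dg.
have hE : h \o shift a = cst (h a) + 'd g a +o_ 0 id.
  apply/eqaddoE/eqaddoP => e e0.
  have /eqaddoP/(_ e e0) := diff_locally dg.
  have gh0 : \forall b \near 0, g (b + a) = h (b + a).
    by move: gh; rewrite (near_shift 0) subr0.
  move=> H; near=> b.
  rewrite /= !fctE /= -(near gh0 b) // -(nbhs_singleton gh).
  exact: (near H b).
have dhE : 'd h a = 'd g a :> (V -> R).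
  by apply: diff_unique => //; exact: diff_continuous.
apply/diff_locallyP; rewrite dhE; split => //; exact: diff_continuous.
Unshelve. all: by end_near. Qed.

Lemma differentiable_eq_on U g h a : open U -> {in U, g =1 h} -> a \in U ->
  differentiable g a -> differentiable h a.
Proof.
move=> oU gh aU; apply: near_eq_differentiable.
by apply: filterS (near_in_open oU aU) => b /gh.
Qed.

Lemma iter_derive_rcons vs w g :
  iter_derive (rcons vs w) g = iter_derive vs ('D_w g).
Proof. by rewrite /iter_derive foldr_rcons. Qed.

Lemma smooth_derive U g w : smooth U g -> smooth U ('D_w g).
Proof. by move=> sg vs a; rewrite -iter_derive_rcons; exact: sg. Qed.

Lemma smooth_differentiable U g a : smooth U g -> a \in U -> differentiable g a.
Proof. by rewrite in_setE => sg /(sg [::]). Qed.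

Lemma smooth_derivable U g a w : smooth U g -> a \in U -> derivable g a w.
Proof. by move=> sg /(smooth_differentiable sg)/diff_derivable. Qed.

(* Gives the smoothness of products and powers without formulas for their
   iterated derivatives. *)
Lemma smooth_coind U (C : (V -> R) -> Prop) : open U ->
  (forall g a, C g -> a \in U -> differentiable g a) ->
  (forall g w, C g -> exists2 h, C h & {in U, 'D_w g =1 h}) ->
  forall g, C g -> smooth U g.
Proof.
move=> oU dC DC g Cg vs.
suff [h Ch gh] : exists2 h, C h & {in U, iter_derive vs g =1 h}.
  move=> a Ua; have aU : a \in U by rewrite in_setE.
  by apply: (differentiable_eq_on oU _ aU (dC _ _ Ch aU)) => b bU; rewrite gh.
elim: vs => [|w vs [h Ch gh]] /=; first by exists g.
have [h' Ch' hh'] := DC h w Ch; exists h' => // a aU.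
by rewrite (derive_eq_on w oU gh aU) hh'.
Qed.

Lemma smooth_eq_on U g h : open U -> {in U, g =1 h} -> smooth U g -> smooth U h.
Proof.
move=> oU gh sg; apply: (@smooth_coind U
  (fun h => exists2 g, smooth U g & {in U, g =1 h})) => //; last by exists g.
  move=> k a [k' sk' kk'] aU.
  exact: (differentiable_eq_on oU kk' aU (smooth_differentiable sk' aU)).
move=> k w [k' sk' kk']; exists ('D_w k'); first by exists ('D_w k') => //;
  exact: smooth_derive.
by move=> a aU; rewrite (derive_eq_on w oU kk').
Qed.

Inductive algebra_gen (G : (V -> R) -> Prop) : (V -> R) -> Prop :=
| alg_gen g : G g -> algebra_gen G g
| alg_cst c : algebra_gen G (cst c)
| alg_add g h : algebra_gen G g -> algebra_gen G h ->
    algebra_gen G (fun a => g a + h a)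
| alg_mul g h : algebra_gen G g -> algebra_gen G h ->
    algebra_gen G (fun a => g a * h a).

(** By the Leibniz rule the generated algebra is stable under differentiation as soon as the
    derivatives of the generators lie in it, and [smooth_coind] applies. It is used with three kinds
    of generators: smooth functions, coordinates, and the parts of complex powers. *)
Lemma smooth_algebra_gen U (G : (V -> R) -> Prop) : open U ->
  (forall g a, G g -> a \in U -> differentiable g a) ->
  (forall g w, G g -> exists2 h, algebra_gen G h & {in U, 'D_w g =1 h}) ->
  forall g, algebra_gen G g -> smooth U g.
Proof.
move=> oU dG DG.
have dC g a : algebra_gen G g -> a \in U -> differentiable g a.
  move=> Gg aU; elim: Gg => {g} [g Gg|c|g h _ dg _ dh|g h _ dg _ dh].
  - exact: dG.
  - exact: differentiable_cst.
  - exact: differentiableD.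
  - exact: differentiableM.
apply: smooth_coind => // g w.
elim => {g} [g Gg|c|g h Gg [g' Gg' gg'] Gh [h' Gh' hh']|
             g h Gg [g' Gg' gg'] Gh [h' Gh' hh']].
- exact: DG.
- by exists (cst 0); [exact: alg_cst | move=> a _; exact: derive_cst].
- exists (fun a => g' a + h' a); first exact: alg_add.
  move=> a aU; rewrite deriveD ?gg' ?hh' //; apply: diff_derivable; exact: dC.
- exists (fun a => g a * h' a + h a * g' a).
    by apply: alg_add; exact: alg_mul.
  move=> a aU; rewrite deriveM ?gg' ?hh' //; apply: diff_derivable; exact: dC.
Qed.

Lemma smooth_algebra U : open U -> forall g, algebra_gen (smooth U) g -> smooth U g.
Proof.
move=> oU; apply: smooth_algebra_gen => // [g a|g w sg].
  exact: smooth_differentiable.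
by exists ('D_w g) => //; apply: alg_gen; exact: smooth_derive.
Qed.

Lemma smooth_cst U c : open U -> smooth U (cst c).
Proof. by move=> oU; apply: smooth_algebra => //; exact: alg_cst. Qed.

Lemma smoothD U g h : open U -> smooth U g -> smooth U h ->
  smooth U (fun a => g a + h a).
Proof.
by move=> oU sg sh; apply: smooth_algebra => //; apply: alg_add; exact: alg_gen.
Qed.

Lemma smoothM U g h : open U -> smooth U g -> smooth U h ->
  smooth U (fun a => g a * h a).
Proof.
by move=> oU sg sh; apply: smooth_algebra => //; apply: alg_mul; exact: alg_gen.
Qed.

Lemma smoothB U g h : open U -> smooth U g -> smooth U h ->
  smooth U (fun a => g a - h a).
Proof.
move=> oU sg sh.
have sNh := smoothM oU (smooth_cst (-1) oU) sh.
by apply: smooth_eq_on (smoothD oU sg sNh) => // a _; rewrite mulN1r.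
Qed.

Lemma smooth_sum U (I : Type) (r : seq I) (F : I -> V -> R) : open U ->
  (forall i, smooth U (F i)) -> smooth U (fun a => \sum_(i <- r) F i a).
Proof.
move=> oU sF; elim: r => [|i r IHr].
  by apply: smooth_eq_on (smooth_cst 0 oU) => // a _; rewrite big_nil.
by apply: smooth_eq_on (smoothD oU (sF i) IHr) => // a _; rewrite big_cons.
Qed.

Lemma derive1_line g a v : derive1 (fun u : R => g (a + u *: v)) 0 = 'D_v g a.
Proof.
rewrite /derive1 /derive.
set F := (F in F @ _); set G := (G in _ = lim (G @ _)).
suff -> : F = G by [].
by apply/funext => h; rewrite /F /G addr0 scale0r addr0 [a + _]addrC.
Qed.

Lemma is_derive_line g a v t : derivable g (a + t *: v) v ->
  is_derive t 1 (fun u => g (a + u *: v)) ('D_v g (a + t *: v)).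
Proof.
have E : (fun h : R => h^-1 *: (g (a + (h *: (1 : R) + t) *: v) - g (a + t *: v))) =
         (fun h : R => h^-1 *: (g (h *: v + (a + t *: v)) - g (a + t *: v))).
  apply/funext => h; congr (_ *: (g _ - _)).
  by rewrite -[h *: 1]/(h * 1) mulr1 scalerDl addrCA.
move=> dg; apply: DeriveDef; first by rewrite /derivable /= E.
by rewrite /derive E.
Qed.

Lemma MVT_line g a v (h : R) : 0 < h ->
  (forall t, 0 <= t <= h -> derivable g (a + t *: v) v) ->
  exists2 t, 0 <= t <= h & g (a + h *: v) - g a = h * 'D_v g (a + t *: v).
Proof.
move=> h0 dg.
have [||t tI E] := @MVT R (fun u => g (a + u *: v))
   (fun u => 'D_v g (a + u *: v)) 0 h h0.
- move=> t tI; apply: is_derive_line; apply: dg.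
  by move: tI; rewrite in_itv /= => /andP[/ltW-> /ltW->].
- apply: derivable_within_continuous => t tI.
  have [|//] := @is_derive_line g a v t.
  by apply: dg; move: tI; rewrite in_itv.
exists t; first by move: tI; rewrite in_itv /= => /andP[/ltW-> /ltW->].
by move: E; rewrite scale0r addr0 subr0 mulrC.
Qed.

(** Two mean value theorems on segments: for [p b = g (b + h w) - g b] in the direction [v], then
    for ['D_v g] in the direction [w]. The quotient is thus the mixed derivative at some
    [a + t v + u w] with [t] and [u] in [[0, h]], and that derivative is continuous at [a]. *)
Lemma second_difference U g a v w (e : R) : open U -> smooth U g -> U a -> 0 < e ->
  \forall h \near (0 : R)^'+, `|h ^- 2 *
    ((g (a + h *: v + h *: w) - g (a + h *: v)) - (g (a + h *: w) - g a))
     - 'D_w ('D_v g) a| < e.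
Proof.
move=> oU sg Ua e0.
have aU : a \in U by rewrite in_setE.
have : \forall b \near a, U b /\ `|'D_w ('D_v g) b - 'D_w ('D_v g) a| < e.
  near=> b; split; near: b; first by apply: open_nbhs_nbhs.
  have /differentiable_continuous/cvgr_distC_lt/(_ e e0) :=
    smooth_differentiable (smooth_derive w (smooth_derive v sg)) aU.
  exact.
move=> /nbhs_ballP[r /= r0 rP].
(* The bound [h * M < r] keeps every [a + t v + u w] with [t, u <= h] in the ball where the mixed
   derivative is [e]-close to its value at [a]. The summand 1 makes [M] positive even when
   [v = w = 0]. *)
pose M := `|v| + `|w| + 1.
have M0 : 0 < M by rewrite /M ltr_wpDl // addr_ge0.
near=> h.
have h0 : 0 < h by [].
have hr : h * M < r by rewrite -ltr_pdivlMr //; near: h; apply: nbhs_right_lt;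
  exact: divr_gt0.
have inB t u : 0 <= t <= h -> 0 <= u <= h -> ball a r (a + t *: v + u *: w).
  move=> /andP[t0 th] /andP[u0 uh];
    rewrite -ball_normE /= -addrA opprD addNKr normrN.
  apply: le_lt_trans hr; apply: (le_trans (ler_normD _ _)).
  rewrite !normrZ !ger0_norm // /M mulrDr mulrDr.
  rewrite -[X in X <= _]addr0; apply: lerD; last by rewrite mulr1 ltW.
  by apply: lerD; apply: ler_wpM2r.
have inU t u : 0 <= t <= h -> 0 <= u <= h -> a + t *: v + u *: w \in U.
  by move=> t0 u0; rewrite in_setE; case: (rP _ (inB t u t0 u0)).
have hh : 0 <= h <= h by rewrite ltW /=.
have h00 : 0 <= (0 : R) <= h by rewrite lexx ltW.
pose p b := g (b + h *: w) - g b.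
have shiftD t : 0 <= t <= h -> is_derive (a + t *: v) v (fun b => g (b + h *: w))
     ('D_v g (a + t *: v + h *: w)).
  move=> t0; have dg := @smooth_derivable _ _ _ v sg (inU t h t0 hh).
  have E : (fun k : R => k^-1 *: (g ((k *: v + (a + t *: v)) + h *: w) - g (a +
    t *: v + h *: w))) =
     (fun k : R => k^-1 *: (g (k *: v + ((a + t *: v) + h *: w)) - g (a + t *: v
       + h *: w))).
    by apply/funext => k; rewrite -(addrA (k *: v) (a + t *: v)).
  apply: DeriveDef; first by rewrite /derivable /= E.
  by rewrite /derive /= E.
have dp t : 0 <= t <= h -> derivable p (a + t *: v) v.
  move=> t0; apply: derivableB; first by case: (shiftD t t0).
  by apply: smooth_derivable sg _; have := inU t 0 t0 h00; rewrite scale0r addr0.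
have [t t0 E1] := MVT_line h0 dp.
have [u u0 E2] : exists2 u, 0 <= u <= h &
    'D_v g (a + t *: v + h *: w) - 'D_v g (a + t *: v) =
    h * 'D_w ('D_v g) (a + t *: v + u *: w).
  apply: (@MVT_line ('D_v g) (a + t *: v) w h h0) => u u0.
  by apply: smooth_derivable (smooth_derive v sg) _; exact: inU.
have Dp : 'D_v p (a + t *: v) = 'D_v g (a + t *: v + h *: w) - 'D_v g (a + t *: v).
  have [dgs dgsE] := shiftD t t0.
  rewrite -dgsE; apply: deriveB => //.
  by apply: smooth_derivable sg _; have := inU t 0 t0 h00; rewrite scale0r addr0.
move: E1; rewrite Dp E2 /p => ->.
rewrite mulrA -expr2 mulrA mulVf ?expf_neq0 ?gt_eqF // mul1r.
by case: (rP _ (inB t u t0 u0)).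
Unshelve. all: by end_near. Qed.

(** The second difference is symmetric in [v] and [w], and for one small [h] it is within [e / 2] of
    both mixed derivatives. *)
Lemma derive_comm U g v w : open U -> smooth U g ->
  {in U, 'D_w ('D_v g) =1 'D_v ('D_w g)}.
Proof.
move=> oU sg a; rewrite in_setE => Ua.
apply/eqP; rewrite -subr_eq0 -normr_le0; apply/ler_addgt0Pr => e e0; rewrite add0r.
have e20 : 0 < e / 2 by rewrite divr_gt0.
have [h /= [H1 H2]] := filter_ex (filterI
  (second_difference v w oU sg Ua e20) (second_difference w v oU sg Ua e20)).
move: H2; rewrite (addrAC a (h *: w)).
set x := g _ in H1 *; set y := g _ in H1 *; set z := g _ in H1 *.
have -> : x - z - (y - g a) = x - y - (z - g a) by ring.
set q := _ * _ in H1 * => H2.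
rewrite (le_trans (ler_distD q _ _)) // (splitr e) ltW // ltrD //.
by rewrite distrC; exact: H1.
Qed.

End SmoothFunctions.

(** * Left-invariant vector fields in coordinates *)

Section LinearMaps.
Context {R : pzRingType} {V W : lmodType R} (f : V -> W) (fL : linear f).

Lemma lin0 : f 0 = 0.
Proof. by have := fL (-1) 0 0; rewrite scaler0 addr0 scaleN1r addNr. Qed.

Lemma linD x y : f (x + y) = f x + f y.
Proof. by have := fL 1 x y; rewrite !scale1r. Qed.

Lemma linZ c x : f (c *: x) = c *: f x.
Proof. by have := fL c x 0; rewrite lin0 !addr0. Qed.

Lemma linsum (I : Type) (r : seq I) (P : pred I) (F : I -> V) :
  f (\sum_(i <- r | P i) F i) = \sum_(i <- r | P i) f (F i).
Proof. exact: (big_morph f linD lin0). Qed.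

End LinearMaps.

Section Bracket.
Context {R : realType} {n : vectType R} (br : n -> n -> n).
Hypothesis brP : lie_bracket br.

Lemma br_linr x : linear (br x). Proof. by case: brP. Qed.
Lemma br_linl y : linear (br^~ y). Proof. by case: brP. Qed.

Lemma brDr x y w : br x (y + w) = br x y + br x w.
Proof. exact: (linD (br_linr x)). Qed.

Lemma brDl x y w : br (x + y) w = br x w + br y w.
Proof. exact: (linD (br_linl w)). Qed.

Lemma brZr c x y : br x (c *: y) = c *: br x y.
Proof. exact: (linZ (br_linr x)). Qed.

Lemma brZl c x y : br (c *: x) y = c *: br x y.
Proof. exact: (linZ (br_linl y)). Qed.

Lemma br_anti x y : br x y = - br y x.
Proof.
case: brP => _ _ alt _; apply/eqP; rewrite -addr_eq0; apply/eqP.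
by have := alt (x + y); rewrite brDr !brDl !alt add0r addr0 addrC.
Qed.

Lemma mem_bracket_space (U W : {vspace n}) x y :
  x \in U -> y \in W -> br x y \in bracket_space br U W.
Proof.
move=> xU yW; rewrite (coord_vbasis xU) (coord_vbasis yW).
rewrite (linsum (br_linl _)); apply: memv_suml => i _.
rewrite brZl; apply: memvZ.
rewrite (linsum (br_linr _)); apply: memv_suml => j _.
rewrite brZr; apply: memvZ.
apply: memv_span; apply/allpairsP.
by exists ((vbasis U)`_i, (vbasis W)`_j); split=> //; rewrite mem_nth // size_tuple.
Qed.

End Bracket.

Section Coordinates.
Context {R : realType} {n : htypeAlg R}.
Notation V := 'rV[R]_(\dim {:n}).
Notation br := (@ht_br R n).
Notation ip := (@ht_ip R n).
Implicit Types (a b : V) (x y : n) (S : n) (U : set V) (g h : V -> R).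

Lemma br_central x y : x \in ht_z n -> br x y = 0.
Proof.
move=> xz; apply/eqP; rewrite -memv0 -(ht_central n).
by apply: mem_bracket_space (memvf y) => //; exact: ht_brP.
Qed.

Lemma br_center x y : y \in ht_z n -> br x y = 0.
Proof. by move=> yz; rewrite (br_anti (ht_brP n)) br_central // oppr0. Qed.

Lemma full_dec x : exists2 u, u \in ht_v n & exists2 w, w \in ht_z n & x = u + w.
Proof.
have /memv_addP[u uv [w wz ->]] : x \in (ht_v n + ht_z n)%VS by rewrite ht_full
  memvf.
by exists u => //; exists w.
Qed.

Lemma br_mem_z x y : br x y \in ht_z n.
Proof.
have [u uv [w wz ->]] := full_dec x; have [u' uv' [w' wz' ->]] := full_dec y.
rewrite (brDr (ht_brP n)) (br_center _ wz') addr0.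
rewrite (brDl (ht_brP n)) (br_central _ wz) addr0.
by rewrite -(ht_vv n); apply: mem_bracket_space => //; exact: ht_brP.
Qed.

Definition to_coord x : V := \row_i coord (vbasis {:n}) i x.

Lemma of_coordK : cancel of_coord to_coord.
Proof.
move=> a; apply/rowP => i; rewrite mxE coord_sum_free //.
exact: basis_free (vbasisP _).
Qed.

Lemma to_coordK : cancel to_coord of_coord.
Proof.
move=> x; rewrite /of_coord [RHS](coord_vbasis (memvf x)).
by apply: eq_bigr => i _; rewrite mxE.
Qed.

Lemma of_coord_linear : linear (@of_coord R n).
Proof.
move=> c a b; rewrite /of_coord scaler_sumr -big_split.
by apply: eq_bigr => i _; rewrite !mxE scalerDl scalerA.
Qed.

Lemma to_coord_linear : linear to_coord.
Proof. by move=> c x y; apply/rowP => i; rewrite !mxE linearP. Qed.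

(* The left-invariant vector field S at the point x is the directional
   derivative along S + [x, S] / 2. *)
Definition field_dir S x : n := S + 2^-1 *: br x S.

Definition field_vec S a : V := to_coord (field_dir S (of_coord a)).

(** As [exp] is the identity and the bracket is bilinear, the curve is affine in [t]. A
    left-invariant field is therefore a directional derivative in a direction that depends on the
    point. *)
Lemma group_mul_line S a (t : R) :
  group_mul (of_coord a) (t *: S) = of_coord (a + t *: field_vec S a).
Proof.
rewrite (linD of_coord_linear) (linZ of_coord_linear) to_coordK.
rewrite /group_mul /field_dir (brZr (ht_brP n)).
by rewrite scalerDr !scalerA [t * _]mulrC addrA.
Qed.

Definition real_field S g a : R := 'D_(field_vec S a) g a.

Definition re_coord (f : n -> R[i]) a : R := complex.Re (f (of_coord a)).
Definition im_coord (f : n -> R[i]) a : R := complex.Im (f (of_coord a)).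

Lemma derive1_affine (c d : R) : derive1 (fun u : R => c + u * d) 0 = d.
Proof.
by rewrite derive1E deriveD // derive_cst add0r deriveMr // derive_id [LHS]mulr1.
Qed.

Lemma vfieldE S (f : n -> R[i]) a :
  vfield S f (of_coord a) =
  real_field S (re_coord f) a +i* real_field S (im_coord f) a.
Proof.
rewrite /vfield /cderive1 /real_field -!derive1_line.
by congr (derive1 _ _ +i* derive1 _ _); apply/funext => t;
  rewrite group_mul_line.
Qed.

Lemma smooth_coord U j : open U -> smooth U (fun a : V => a 0 j).
Proof.
move=> oU; apply: (@smooth_algebra_gen _ _ U (eq (fun a : V => a 0 j))) => //.
- by move=> g a <- _; exact: differentiable_coord.
- move=> g w <-; exists (cst (w 0 j)); first exact: alg_cst.
  move=> a _ /=; rewrite -derive1_line.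
  have -> : (fun u : R => (a + u *: w) 0 j) = (fun u => a 0 j + u * w 0 j).
    by apply/funext => u; rewrite !mxE.
  exact: derive1_affine.
- exact: alg_gen.
Qed.

Lemma smooth_linear U (l : n -> R) : open U -> scalar l ->
  smooth U (fun a => l (of_coord a)).
Proof.
move=> oU ll; apply: (@smooth_eq_on _ _ U
  (fun a => \sum_i a 0 i * l (vbasis {:n})`_i)) => //.
  by move=> a _; rewrite (linsum (ll : linear _)); apply: eq_bigr => i _;
    rewrite (linZ (ll : linear _)).
apply: smooth_sum => // i; apply: smoothM => //; first exact: smooth_coord.
exact: smooth_cst.
Qed.

Lemma derive_linear (l : n -> R) a w : scalar l ->
  'D_w (fun a => l (of_coord a)) a = l (of_coord w).
Proof.
move=> ll; rewrite -derive1_line.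
have -> : (fun u : R => l (of_coord (a + u *: w))) =
    (fun u => l (of_coord a) + u * l (of_coord w)).
  apply/funext => u; rewrite (linD of_coord_linear) (linZ of_coord_linear).
  by rewrite (linD (ll : linear _)) (linZ (ll : linear _)).
exact: derive1_affine.
Qed.

Lemma derive_coord_sum g a v : differentiable g a ->
  'D_v g a = \sum_i v 0 i * 'D_(delta_mx 0 i) g a.
Proof.
move=> dg; rewrite deriveE // {1}(row_sum_delta v) linear_sum.
by apply: eq_bigr => i _; rewrite linearZ deriveE.
Qed.

Lemma field_vec_coord_scalar S i : 
  scalar (fun x => (to_coord (2^-1 *: br x S)) 0 i).
Proof.
move=> c x y; rewrite (brDl (ht_brP n)) (brZl (ht_brP n)) scalerDr.
by rewrite scalerA mulrC -scalerA to_coord_linear !mxE.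
Qed.

Lemma field_vec_coordE S i a :
  field_vec S a 0 i = to_coord S 0 i + (to_coord (2^-1 *: br (of_coord a) S)) 0 i.
Proof. by rewrite /field_vec /field_dir (linD to_coord_linear) mxE. Qed.

Lemma smooth_field_vec U S i : open U -> smooth U (fun a => field_vec S a 0 i).
Proof.
move=> oU; apply: (@smooth_eq_on _ _ U (fun a => to_coord S 0 i +
   (to_coord (2^-1 *: br (of_coord a) S)) 0 i)) => //.
  by move=> a _; rewrite field_vec_coordE.
apply: smoothD => //; first exact: smooth_cst.
exact: (smooth_linear oU (@field_vec_coord_scalar S i)).
Qed.

Lemma derive_field_vec S i a w : 'D_w (fun a => field_vec S a 0 i) a =
  to_coord (2^-1 *: br (of_coord w) S) 0 i.
Proof.
have -> : (fun a => field_vec S a 0 i) = (fun a => to_coord S 0 i +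
   (to_coord (2^-1 *: br (of_coord a) S)) 0 i).
  by apply/funext => b; rewrite field_vec_coordE.
have sl := @field_vec_coord_scalar S i.
rewrite deriveD //; last first.
  apply: (smooth_derivable (U := setT)); last by rewrite in_setE.
  exact: (smooth_linear openT sl).
by rewrite derive_cst add0r (derive_linear a w sl).
Qed.

Lemma real_field_coord_sum U S g : smooth U g -> {in U, real_field S g =1
  fun a => \sum_i field_vec S a 0 i * 'D_(delta_mx 0 i) g a}.
Proof.
move=> sg a aU; apply: derive_coord_sum; exact: smooth_differentiable sg aU.
Qed.

Lemma smooth_real_field U S g : open U -> smooth U g -> smooth U (real_field S g).
Proof.
move=> oU sg; apply: (@smooth_eq_on _ _ U
    (fun a => \sum_i field_vec S a 0 i * 'D_(delta_mx 0 i) g a)) => //.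
  by move=> a aU; rewrite (real_field_coord_sum S sg).
apply: smooth_sum => // i; apply: smoothM => //; first exact: smooth_field_vec.
exact: smooth_derive.
Qed.

Lemma real_field_eq_on U S g h : open U -> {in U, g =1 h} ->
  {in U, real_field S g =1 real_field S h}.
Proof. by move=> oU gh a aU; exact: derive_eq_on gh _ aU. Qed.

(** Differentiating the coefficients of [S'] along [S] gives a first-order term in the direction
    [[S, S'] / 2], the further bracket being zero since z is central. Once this term vanishes, only
    second derivatives remain, and exchanging the two fields just transposes their coefficients. *)
Lemma real_field_iter U S S' g : open U -> smooth U g -> br S S' = 0 ->
  {in U, real_field S (real_field S' g) =1 fun a =>
   \sum_i \sum_j field_vec S' a 0 i * field_vec S a 0 j *
      'D_(delta_mx 0 j) ('D_(delta_mx 0 i) g) a}.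
Proof.
move=> oU sg SS' a aU.
rewrite (real_field_eq_on S oU (real_field_coord_sum S' sg)) // /real_field.
set v := field_vec S a.
have dF i : derivable (fun b : V => field_vec S' b 0 i * 'D_(delta_mx 0 i) g b) a v.
  apply: smooth_derivable aU; apply: smoothM => //; first exact: smooth_field_vec.
  exact: smooth_derive.
have -> : (fun b : V => \sum_i field_vec S' b 0 i * 'D_(delta_mx 0 i) g b) =
    \sum_i (fun b : V => field_vec S' b 0 i * 'D_(delta_mx 0 i) g b).
  by apply/funext => b; rewrite fct_sumE.
rewrite derive_sum //; apply: eq_bigr => i _.
rewrite deriveM; last 2 first.
- by apply: smooth_derivable aU; exact: smooth_field_vec.
- by apply: smooth_derivable aU; exact: smooth_derive.
have -> : 'D_v (fun b => field_vec S' b 0 i) a = 0.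
  rewrite derive_field_vec /v /field_vec to_coordK /field_dir.
  rewrite (brDl (ht_brP n)) (brZl (ht_brP n)) SS'.
  by rewrite (br_central _ (br_mem_z _ _)) !(scaler0, addr0) (lin0
    to_coord_linear) mxE.
rewrite scaler0 addr0 derive_coord_sum; last first.
  by apply: smooth_differentiable aU; exact: smooth_derive.
by rewrite scaler_sumr; apply: eq_bigr => j _; rewrite /GRing.scale /= mulrA.
Qed.

Lemma real_field_comm U S S' g : open U -> smooth U g -> br S S' = 0 ->
  {in U, real_field S (real_field S' g) =1 real_field S' (real_field S g)}.
Proof.
move=> oU sg SS' a aU; rewrite (real_field_iter oU sg SS' aU).
have S'S : br S' S = 0 by rewrite (br_anti (ht_brP n)) SS' oppr0.
rewrite (real_field_iter oU sg S'S aU) exchange_big /=.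
apply: eq_bigr => i _; apply: eq_bigr => j _.
by rewrite (derive_comm _ _ oU sg aU) [_ * field_vec S a 0 i]mulrC.
Qed.

End Coordinates.

(** * Differential operators on smooth complex functions *)

Section ReIm.
Context {R : realType}.

Lemma ReD (z w : R[i]) : complex.Re (z + w) = complex.Re z + complex.Re w.
Proof. by case: z w => [? ?] [? ?]. Qed.
Lemma ImD (z w : R[i]) : complex.Im (z + w) = complex.Im z + complex.Im w.
Proof. by case: z w => [? ?] [? ?]. Qed.
Lemma ReM (z w : R[i]) : complex.Re (z * w) =
  complex.Re z * complex.Re w - complex.Im z * complex.Im w.
Proof. by case: z w => [? ?] [? ?]. Qed.
Lemma ImM (z w : R[i]) : complex.Im (z * w) =
  complex.Re z * complex.Im w + complex.Im z * complex.Re w.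
Proof. by case: z w => [? ?] [? ?]. Qed.

End ReIm.

Section ComplexFunctions.
Context {R : realType} {n : htypeAlg R}.
Implicit Types (U : set n) (f g h : n -> R[i]) (S : n).
Local Notation V := 'rV[R]_(\dim {:n}).
Local Notation chart U := (@of_coord R n @^-1` U).

Lemma smooth_onP U f :
  smooth_on U f <-> smooth (chart U) (re_coord f) /\ smooth (chart U) (im_coord f).
Proof. by []. Qed.

Lemma chart_in U x : U x -> to_coord x \in chart U.
Proof. by move=> Ux; rewrite in_setE /preimage /= to_coordK. Qed.

Lemma smooth_on_eq U f g : open_in U -> (forall x, U x -> f x = g x) ->
  smooth_on U f -> smooth_on U g.
Proof.
move=> oU fg [sr si]; split;
  [apply: smooth_eq_on sr|apply: smooth_eq_on si] => // a;
  by rewrite in_setE /re_coord /im_coord => /fg ->.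
Qed.

Lemma smooth_on_cst U c : open_in U -> smooth_on U (fun=> c).
Proof. by move=> oU; split; exact: (@smooth_cst _ _ (chart U)). Qed.

Lemma smooth_on_real U (g : n -> R) : open_in U ->
  smooth (chart U) (fun a => g (of_coord a)) -> smooth_on U (fun x => (g x)%:C).
Proof. by move=> oU sg; split => //; exact: (@smooth_cst _ _ (chart U)). Qed.

Lemma smooth_onD U f g : open_in U -> smooth_on U f -> smooth_on U g ->
  smooth_on U (fun x => f x + g x).
Proof.
move=> oU [fr fi] [gr gi]; split.
  apply: smooth_eq_on (smoothD oU fr gr) => // a _; exact: esym (ReD _ _).
apply: smooth_eq_on (smoothD oU fi gi) => // a _; exact: esym (ImD _ _).
Qed.

Lemma smooth_onM U f g : open_in U -> smooth_on U f -> smooth_on U g ->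
  smooth_on U (fun x => f x * g x).
Proof.
move=> oU [fr fi] [gr gi]; split.
  apply: smooth_eq_on (smoothB oU (smoothM oU fr gr) (smoothM oU fi gi)) => // a _.
  exact: esym (ReM _ _).
apply: smooth_eq_on (smoothD oU (smoothM oU fr gi) (smoothM oU fi gr)) => // a _.
exact: esym (ImM _ _).
Qed.

Lemma smooth_onZ U c f : open_in U -> smooth_on U f -> smooth_on U (fun x => c *
  f x).
Proof. by move=> oU; apply: smooth_onM => //; exact: smooth_on_cst. Qed.

Lemma smooth_onX U f m : open_in U -> smooth_on U f -> smooth_on U (fun x => f x
  ^+ m).
Proof.
move=> oU sf; elim: m => [|m IHm]; first exact: smooth_on_cst.
by apply: smooth_on_eq (smooth_onM oU sf IHm) => // x _; rewrite exprS.
Qed.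

Lemma smooth_on_sum U (I : Type) (r : seq I) (P : pred I) (F : I -> n -> R[i]) :
  open_in U -> (forall i, P i -> smooth_on U (F i)) ->
  smooth_on U (fun x => \sum_(i <- r | P i) F i x).
Proof.
move=> oU sF; elim: r => [|i r IHr].
  by apply: smooth_on_eq (smooth_on_cst 0 oU) => // x _; rewrite big_nil.
case Pi: (P i); last by apply: smooth_on_eq IHr => // x _; rewrite big_cons Pi.
by apply: smooth_on_eq (smooth_onD oU (sF i Pi) IHr) => // x _; rewrite big_cons Pi.
Qed.

Lemma vfield_to_coord S f x : vfield S f x =
  real_field S (re_coord f) (to_coord x) +i* real_field S (im_coord f) (to_coord x).
Proof. by rewrite -vfieldE to_coordK. Qed.

Lemma re_coord_vfield S f : re_coord (vfield S f) = real_field S (re_coord f).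
Proof. by apply/funext => a; rewrite /re_coord vfieldE. Qed.

Lemma im_coord_vfield S f : im_coord (vfield S f) = real_field S (im_coord f).
Proof. by apply/funext => a; rewrite /im_coord vfieldE. Qed.

Lemma smooth_on_vfield U S f : open_in U -> smooth_on U f -> smooth_on U (vfield
  S f).
Proof.
move=> oU /smooth_onP[sr si]; apply/smooth_onP.
by rewrite re_coord_vfield im_coord_vfield; split; exact: smooth_real_field.
Qed.

Lemma vfield_local U S f g : open_in U -> (forall x, U x -> f x = g x) ->
  forall x, U x -> vfield S f x = vfield S g x.
Proof.
move=> oU fg x Ux; rewrite !vfield_to_coord.
by congr (_ +i* _); apply: (@real_field_eq_on _ _ (chart U)) (chart_in Ux) => // a;
  rewrite in_setE /re_coord /im_coord => /fg ->.
Qed.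

Section RealFieldRules.
Variables (U : set V) (S : n) (g h : V -> R) (a : V).
Hypotheses (sg : smooth U g) (sh : smooth U h) (aU : a \in U).

Lemma real_fieldD : real_field S (fun b => g b + h b) a = real_field S g a +
  real_field S h a.
Proof. by apply: deriveD;
  [exact: smooth_derivable sg aU|exact: smooth_derivable sh aU]. Qed.

Lemma real_fieldB : real_field S (fun b => g b - h b) a = real_field S g a -
  real_field S h a.
Proof. by apply: deriveB;
  [exact: smooth_derivable sg aU|exact: smooth_derivable sh aU]. Qed.

Lemma real_fieldM : real_field S (fun b => g b * h b) a =
  real_field S g a * h a + g a * real_field S h a.
Proof.
rewrite /real_field [LHS]deriveM.
- by rewrite addrC [X in X + _]mulrC.
- exact: smooth_derivable sg aU.
- exact: smooth_derivable sh aU.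
Qed.
End RealFieldRules.

Lemma vfieldD U S f g x : open_in U -> smooth_on U f -> smooth_on U g -> U x ->
  vfield S (fun y => f y + g y) x = vfield S f x + vfield S g x.
Proof.
move=> oU [fr fi] [gr gi] Ux; rewrite !vfield_to_coord.
have -> : re_coord (fun y => f y + g y) = fun a => re_coord f a + re_coord g a.
  by apply/funext => a; exact: ReD.
have -> : im_coord (fun y => f y + g y) = fun a => im_coord f a + im_coord g a.
  by apply/funext => a; exact: ImD.
by rewrite (real_fieldD S fr gr (chart_in Ux)) (real_fieldD S fi gi (chart_in Ux)).
Qed.

Lemma vfieldM U S f g x : open_in U -> smooth_on U f -> smooth_on U g -> U x ->
  vfield S (fun y => f y * g y) x = vfield S f x * g x + f x * vfield S g x.
Proof.
move=> oU [fr fi] [gr gi] Ux; rewrite !vfield_to_coord.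
have -> : re_coord (fun y => f y * g y) = fun a => re_coord f a * re_coord g a -
  im_coord f a * im_coord g a.
  by apply/funext => a; exact: ReM.
have -> : im_coord (fun y => f y * g y) = fun a => re_coord f a * im_coord g a +
  im_coord f a * re_coord g a.
  by apply/funext => a; exact: ImM.
have xU := chart_in Ux.
rewrite (real_fieldB S (smoothM oU fr gr) (smoothM oU fi gi) xU).
rewrite (real_fieldD S (smoothM oU fr gi) (smoothM oU fi gr) xU).
rewrite (real_fieldM S fr gr xU) (real_fieldM S fi gi xU).
rewrite (real_fieldM S fr gi xU) (real_fieldM S fi gr xU).
rewrite /re_coord /im_coord to_coordK.
case: (f x) (g x) => [a b] [c d] /=; apply/eqP; rewrite eq_complex /=.
by apply/andP; split; apply/eqP; ring.
Qed.

Lemma vfield_cst S c x : vfield S (fun=> c) x = 0.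
Proof.
rewrite vfield_to_coord; apply/eqP; rewrite eq_complex /=.
by rewrite /real_field !derive_cst !eqxx.
Qed.

Lemma vfieldZ U S c f x : open_in U -> smooth_on U f -> U x ->
  vfield S (fun y => c * f y) x = c * vfield S f x.
Proof.
move=> oU sf Ux; rewrite (vfieldM S oU (smooth_on_cst c oU) sf Ux).
by rewrite vfield_cst mul0r add0r.
Qed.

Lemma vfield_comm U S S' f x : open_in U -> smooth_on U f -> ht_br S S' = 0 -> U
  x ->
  vfield S (vfield S' f) x = vfield S' (vfield S f) x.
Proof.
move=> oU [fr fi] SS' Ux;
  rewrite !vfield_to_coord !re_coord_vfield !im_coord_vfield.
rewrite (real_field_comm oU fr SS' (chart_in Ux)).
by rewrite (real_field_comm oU fi SS' (chart_in Ux)).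
Qed.

End ComplexFunctions.

Section DiffOps.
Context {R : realType} {n : htypeAlg R}.
Implicit Types (U : set n) (f g h : n -> R[i]) (S : n) (A B C : oper n).
Notation lido := left_invariant_diffop.

Lemma lido_smooth A : lido A -> forall U f, open_in U -> smooth_on U f ->
  smooth_on U (A f).
Proof.
elim=> {A} [|S|A B _ IHA _ IHB|c A _ IHA|A B _ IHA _ IHB] U f oU sf //.
- exact: smooth_on_vfield.
- by apply: smooth_onD => //; [exact: IHA|exact: IHB].
- by apply: smooth_onZ => //; exact: IHA.
- by apply: IHA => //; exact: IHB.
Qed.

(** The formulas for operators applied to K_s hold only on an open set; locality is what allows them
    to be rewritten under an outer operator. *)
Lemma lido_local A : lido A -> forall U f g, open_in U ->
  (forall x, U x -> f x = g x) -> forall x, U x -> A f x = A g x.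
Proof.
elim=> {A} [|S|A B _ IHA _ IHB|c A _ IHA|A B _ IHA _ IHB] U f g oU fg x Ux.
- exact: fg.
- exact: vfield_local fg _ Ux.
- by rewrite /oper_add (IHA _ _ _ oU fg) // (IHB _ _ _ oU fg).
- by rewrite /oper_scale (IHA _ _ _ oU fg).
- by apply: (IHA _ _ _ oU) Ux => y; exact: IHB.
Qed.

Lemma lidoD A : lido A -> forall U f g, open_in U -> smooth_on U f -> smooth_on
  U g ->
  forall x, U x -> A (fun y => f y + g y) x = A f x + A g x.
Proof.
elim=> {A} [|S|A B _ IHA _ IHB|c A _ IHA|A B lA IHA lB IHB] U f g oU sf sg x Ux.
- by [].
- exact: vfieldD sf sg Ux.
- by rewrite /oper_add (IHA _ _ _ oU sf sg) // (IHB _ _ _ oU sf sg) // addrACA.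
- by rewrite /oper_scale (IHA _ _ _ oU sf sg) // mulrDr.
- rewrite /oper_comp -(IHA _ _ _ oU) //; [|exact: lido_smooth..].
  by apply: (lido_local lA oU) Ux => y; exact: IHB.
Qed.

Lemma lidoZ A : lido A -> forall U c f, open_in U -> smooth_on U f ->
  forall x, U x -> A (fun y => c * f y) x = c * A f x.
Proof.
elim=> {A} [|S|A B _ IHA _ IHB|c A _ IHA|A B lA IHA lB IHB] U k f oU sf x Ux.
- by [].
- exact: vfieldZ sf Ux.
- by rewrite /oper_add (IHA _ _ _ oU sf) // (IHB _ _ _ oU sf) // mulrDr.
- by rewrite /oper_scale (IHA _ _ _ oU sf) // mulrCA.
- rewrite /oper_comp -(IHA _ _ _ oU) //; last exact: lido_smooth.
  by apply: (lido_local lA oU) Ux => y; exact: IHB.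
Qed.

Lemma lido_sum A : lido A -> forall U (I : Type) (r : seq I) (P : pred I)
    (F : I -> n -> R[i]), open_in U -> (forall i, P i -> smooth_on U (F i)) ->
  forall x, U x -> A (fun y => \sum_(i <- r | P i) F i y) x = \sum_(i <- r | P
    i) A (F i) x.
Proof.
move=> lA U I r P F oU sF x Ux.
elim: r => [|i r IHr].
  rewrite big_nil -[RHS](mul0r (A (fun=> 0) x)) -(lidoZ lA 0 oU (smooth_on_cst 0
    oU) Ux).
  by apply: (lido_local lA oU) Ux => y _; rewrite big_nil mul0r.
rewrite big_cons; case Pi: (P i); last first.
  by rewrite -IHr; apply: (lido_local lA oU) Ux => y _; rewrite big_cons Pi.
rewrite -IHr -(lidoD lA oU (sF i Pi) (smooth_on_sum r oU sF) Ux).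
by apply: (lido_local lA oU) Ux => y _; rewrite big_cons Pi.
Qed.

Lemma lido_exp A m : lido A -> lido (oper_exp A m).
Proof. by move=> lA; elim: m => [|m IHm]; [exact: lido_id|exact: lido_comp]. Qed.

Lemma sum_squares_nil : sum_squares [::] = oper_scale 0 oper_id :> oper n.
Proof. by apply/funext => f; apply/funext => x;
  rewrite /sum_squares big_nil /oper_scale mul0r. Qed.

Lemma sum_squares_cons S r : sum_squares (S :: r) =
  oper_add (oper_comp (vfield S) (vfield S)) (sum_squares r) :> oper n.
Proof. by apply/funext => f; apply/funext => x; rewrite /sum_squares big_cons. Qed.

Lemma lido_sum_squares r : lido (sum_squares r : oper n).
Proof.
elim: r => [|S r IHr]; first by rewrite sum_squares_nil; apply: lido_scale;
  exact: lido_id.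
rewrite sum_squares_cons; apply: lido_add => //.
by apply: lido_comp; exact: lido_vfield.
Qed.

Lemma oper_eq_refl A : oper_eq A A. Proof. by []. Qed.

Lemma oper_eq_sym A B : oper_eq A B -> oper_eq B A.
Proof. by move=> AB U f oU sf x Ux; rewrite (AB U f). Qed.

Lemma oper_eq_trans A B C : oper_eq A B -> oper_eq B C -> oper_eq A C.
Proof. by move=> AB BC U f oU sf x Ux; rewrite (AB U f) // (BC U f). Qed.

Lemma oper_eq_add A A' B B' : oper_eq A A' -> oper_eq B B' ->
  oper_eq (oper_add A B) (oper_add A' B').
Proof. by move=> AA BB U f oU sf x Ux; rewrite /oper_add (AA U f) // (BB U f). Qed.

Lemma oper_eq_scale c A A' : oper_eq A A' -> oper_eq (oper_scale c A)
  (oper_scale c A').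
Proof. by move=> AA U f oU sf x Ux; rewrite /oper_scale (AA U f). Qed.

(** Since [oper_eq] compares operators on smooth functions only, [B] has to preserve smoothness
    here, whereas replacing the right factor requires the left one to be local. *)
Lemma oper_eq_compl A A' B : lido B -> oper_eq A A' -> oper_eq (oper_comp A B)
  (oper_comp A' B).
Proof. by move=> lB AA U f oU sf x Ux; apply: (AA U) => //; exact: lido_smooth. Qed.

Lemma oper_eq_compr A B B' : lido A -> oper_eq B B' -> oper_eq (oper_comp A B)
  (oper_comp A B').
Proof.
by move=> lA BB U f oU sf x Ux; apply: (lido_local lA oU) Ux => y Uy; exact: (BB U).
Qed.

Definition oper_commute A B := oper_eq (oper_comp A B) (oper_comp B A).

Lemma oper_commute_sym A B : oper_commute A B -> oper_commute B A.
Proof. exact: oper_eq_sym. Qed.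

Lemma oper_commute_id A : oper_commute A oper_id. Proof. by []. Qed.

Lemma oper_commuteD A B C : lido A -> lido B -> lido C ->
  oper_commute A B -> oper_commute A C -> oper_commute A (oper_add B C).
Proof.
move=> lA lB lC AB AC U f oU sf x Ux; rewrite /oper_comp /oper_add.
rewrite (lidoD lA oU (lido_smooth lB oU sf) (lido_smooth lC oU sf) Ux).
by congr (_ + _); [exact: AB oU sf _ Ux|exact: AC oU sf _ Ux].
Qed.

Lemma oper_commuteZ A c B : lido A -> lido B ->
  oper_commute A B -> oper_commute A (oper_scale c B).
Proof.
move=> lA lB AB U f oU sf x Ux; rewrite /oper_comp /oper_scale.
rewrite (lidoZ lA c oU (lido_smooth lB oU sf) Ux).
by congr (_ * _); exact: AB oU sf _ Ux.
Qed.

Lemma oper_commuteM A B C : lido A -> lido B -> lido C ->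
  oper_commute A B -> oper_commute A C -> oper_commute A (oper_comp B C).
Proof.
move=> lA lB lC AB AC.
have E1 : oper_eq (oper_comp A (oper_comp B C)) (oper_comp B (oper_comp A C)).
  exact: (oper_eq_compl lC AB).
apply: (oper_eq_trans E1); exact: (oper_eq_compr lB AC).
Qed.

Lemma oper_commuteX A B m : lido A -> lido B -> oper_commute A B -> oper_commute
  A (oper_exp B m).
Proof.
move=> lA lB AB; elim: m => [|m IHm]; first exact: oper_commute_id.
by apply: oper_commuteM => //; exact: lido_exp.
Qed.

Lemma oper_commute_sum_squares A r : lido A ->
  (forall S, S \in r -> oper_commute A (vfield S)) -> oper_commute A
    (sum_squares r).
Proof.
move=> lA; elim: r => [|S r IHr] Ar.
  by rewrite sum_squares_nil; apply: oper_commuteZ => //; exact: lido_id.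
have lS := @lido_vfield _ _ S.
have AS : oper_commute A (vfield S) by apply: Ar; rewrite mem_head.
rewrite sum_squares_cons; apply: oper_commuteD => //.
- exact: lido_comp.
- exact: lido_sum_squares.
- exact: oper_commuteM.
- by apply: IHr => S' S'r; apply: Ar; rewrite in_cons S'r orbT.
Qed.

Lemma sum_squares_commute r r' :
  (forall S S', S \in r -> S' \in r' -> ht_br S S' = 0) ->
  oper_commute (sum_squares r) (sum_squares r' : oper n).
Proof.
move=> rr'; apply: oper_commute_sum_squares; first exact: lido_sum_squares.
move=> S' S'r'; apply: oper_commute_sym; apply: oper_commute_sum_squares.
  exact: lido_vfield.
move=> S Sr; apply: oper_commute_sym => U f oU sf x Ux.
exact: vfield_comm sf (rr' _ _ Sr S'r') Ux.
Qed.

End DiffOps.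

(** * Homogeneous combinations of three commuting operators *)

(** The scheme of [Dop], whose value at [k.+2] and [s] calls [k.+1] at [s] but [k] at [s - 1]; hence
    the quantification over [s] in the hypotheses. *)
Lemma nat_family_ind2 (A : Type) (G : nat -> A -> Prop) :
  (forall s, G 0%N s) -> (forall s, G 1%N s) ->
  (forall k, (forall s, G k s) -> (forall s, G k.+1 s) -> forall s, G k.+2 s) ->
  forall k s, G k s.
Proof.
move=> G0 G1 GS k.
suff [] : (forall s, G k s) /\ (forall s, G k.+1 s) by [].
by elim: k => [|k [IH IH']]; split => //; exact: GS.
Qed.

Section Interpolation.
Context {R : realType}.

Lemma nat_notin_seq (E : seq R[i]) : exists M, forall m, (M <= m)%N -> m%:R
  \notin E.
Proof.
elim: E => [|e E [M HM]]; first by exists 0%N.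
have [[m0 em0]|ne] := pselect (exists m0, m0%:R = e).
  exists (maxn M m0.+1) => m; rewrite geq_max => /andP[Mm m0m].
  by rewrite in_cons negb_or HM // andbT -em0 eqr_nat gtn_eqF.
exists M => m Mm; rewrite in_cons negb_or HM // andbT.
by apply/eqP => me; apply: ne; exists m.
Qed.

(** The nodes are consecutive natural numbers beyond all those in [E], and the weights are the
    values at [s0] of the Lagrange basis. Nodes and weights precede [p] because [p] will depend on
    the function and the point to which an operator is applied. *)
Lemma interpolation (E : seq R[i]) (s0 : R[i]) (N : nat) :
  exists (t : 'I_N -> R[i]) (c : 'I_N -> R[i]),
    (forall i, t i \notin E) /\
    forall p : {poly R[i]}, (size p <= N)%N -> p.[s0] = \sum_i c i * p.[t i].
Proof.
have [M HM] := nat_notin_seq E.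
case: N => [|N].
  exists (fun=> 0), (fun=> 0); split; first by case.
  by move=> p; rewrite leqn0 size_poly_eq0 => /eqP ->; rewrite horner0 big_ord0.
pose t (i : nat) : R[i] := (M + i)%:R.
have tI : injective t by move=> i j /eqP; rewrite eqr_nat eqn_add2l => /eqP.
exists (fun i => t i), (fun i => (tnth (lagrange N.+1 t) i : {poly R[i]}).[s0]).
split => [i|p sp]; first by apply: HM; exact: leq_addr.
rewrite {1}(lagrange_gen (ltn0Sn N) tI sp) horner_sum.
by apply: eq_bigr => i _; rewrite hornerM hornerC mulrC.
Qed.

Lemma poly_eq_cofinite (p q : {poly R[i]}) (E : seq R[i]) :
  (forall s, s \notin E -> p.[s] = q.[s]) -> p = q.
Proof.
move=> pq; apply/eqP; rewrite -subr_eq0.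
have [M HM] := nat_notin_seq E.
pose r := [seq (M + i)%:R : R[i] | i <- iota 0 (size (p - q))].
apply/eqP; apply: (@roots_geq_poly_eq0 _ _ r).
- apply/allP => _ /mapP[i _ ->]; rewrite /root hornerD hornerN pq ?subrr //.
  by apply: HM; exact: leq_addr.
- rewrite map_inj_uniq ?iota_uniq // => i j /eqP.
  by rewrite eqr_nat eqn_add2l => /eqP.
- by rewrite size_map size_iota.
Qed.

End Interpolation.

Section HomogeneousForms.
Context {R : realType} {n : htypeAlg R} (D1 D2 Bx : oper n).
Hypotheses (l1 : left_invariant_diffop D1) (l2 : left_invariant_diffop D2)
  (lB : left_invariant_diffop Bx).
Hypotheses (c21 : oper_commute D2 D1) (cB1 : oper_commute Bx D1)
  (cB2 : oper_commute Bx D2).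
Notation lido := left_invariant_diffop.

Definition monomial i j l : oper n :=
  oper_comp (oper_exp D1 i) (oper_comp (oper_exp D2 j) (oper_exp Bx l)).

Definition form (C : nat -> nat -> nat -> R[i]) (k : nat) : oper n := fun f x =>
  \sum_(i < k.+1) \sum_(j < k.+1) \sum_(l < k.+1 | (i + j + 2 * l == k)%N)
    C i j l * monomial i j l f x.

Definition homogeneous k (A : oper n) : Prop := exists C, oper_eq A (form C k).

Lemma lido_monomial i j l : lido (monomial i j l).
Proof. by apply: lido_comp; [|apply: lido_comp]; exact: lido_exp. Qed.

Lemma homogeneous_eq k A A' : oper_eq A A' -> homogeneous k A' -> homogeneous k A.
Proof. by move=> AA [C CE]; exists C; exact: oper_eq_trans AA CE. Qed.

Lemma homogeneous_add k A B :
  homogeneous k A -> homogeneous k B -> homogeneous k (oper_add A B).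
Proof.
move=> [C AC] [C' BC]; exists (fun i j l => C i j l + C' i j l).
apply: (oper_eq_trans (oper_eq_add AC BC)) => U f _ _ x _.
rewrite /oper_add /form -big_split; apply: eq_bigr => i _ /=.
rewrite -big_split; apply: eq_bigr => j _ /=.
by rewrite -big_split; apply: eq_bigr => l _; rewrite mulrDl.
Qed.

Lemma homogeneous_scale k c A : homogeneous k A -> homogeneous k (oper_scale c A).
Proof.
move=> [C AC]; exists (fun i j l => c * C i j l).
apply: (oper_eq_trans (oper_eq_scale c AC)) => U f _ _ x _.
rewrite /oper_scale /form mulr_sumr; apply: eq_bigr => i _.
rewrite mulr_sumr; apply: eq_bigr => j _.
by rewrite mulr_sumr; apply: eq_bigr => l _; rewrite mulrA.
Qed.

Lemma homogeneous_comp_addl k A B C : homogeneous k (oper_comp A C) ->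
  homogeneous k (oper_comp B C) -> homogeneous k (oper_comp (oper_add A B) C).
Proof. exact: homogeneous_add. Qed.

Lemma homogeneous_comp_scalel k c A C : homogeneous k (oper_comp A C) ->
  homogeneous k (oper_comp (oper_scale c A) C).
Proof. exact: homogeneous_scale. Qed.

Lemma homogeneous_sum k (I : Type) (r : seq I) (P : pred I) (F : I -> oper n) :
  (forall i, P i -> homogeneous k (F i)) ->
  homogeneous k (fun f x => \sum_(i <- r | P i) F i f x).
Proof.
move=> hF; elim: r => [|i r IHr].
  exists (fun _ _ _ => 0) => U f _ _ x _; rewrite big_nil /form big1 // => i _.
  by rewrite big1 // => j _; rewrite big1 // => l _; rewrite mul0r.
case Pi: (P i); last by apply: homogeneous_eq IHr => U f _ _ x _;
  rewrite big_cons Pi.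
apply: homogeneous_eq (homogeneous_add (hF i Pi) IHr) => U f _ _ x _.
by rewrite big_cons Pi.
Qed.

Lemma homogeneous_monomial i j l : homogeneous (i + j + 2 * l) (monomial i j l).
Proof.
set k := (i + j + 2 * l)%N.
have ik : (i < k.+1)%N by rewrite ltnS /k -addnA leq_addr.
have jk : (j < k.+1)%N by rewrite ltnS /k addnAC leq_addl.
have lk : (l < k.+1)%N by rewrite ltnS /k (leq_trans (leq_pmull l (ltn0Sn 1)))
  // leq_addl.
exists (fun i' j' l' => ((i' == i) && (j' == j) && (l' == l))%:R) => U f _ _ x _.
rewrite /form (bigD1 (Ordinal ik)) //= (bigD1 (Ordinal jk)) //=.
rewrite (bigD1 (Ordinal lk)) //= !eqxx mul1r.
rewrite big1 ?addr0; last first.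
  move=> l' /andP[_]; rewrite -val_eqE /= => /negbTE ->; by rewrite mul0r.
rewrite big1 ?addr0; last first.
  move=> j' ; rewrite -val_eqE /= => /negbTE ->; by rewrite big1 // => l' _;
    rewrite mul0r.
rewrite big1 ?addr0 // => i'; rewrite -val_eqE /= => /negbTE ->.
by rewrite big1 // => j' _; rewrite big1 // => l' _; rewrite mul0r.
Qed.

(** On smooth functions [A] passes through the finite sums and the constants of a form, so only its
    effect on monomials matters. *)
Lemma homogeneous_comp k m A B : lido A ->
  (forall i j l, homogeneous (i + j + 2 * l + m) (oper_comp A (monomial i j l))) ->
  homogeneous k B -> homogeneous (k + m) (oper_comp A B).
Proof.
move=> lA Amon [C BC]; apply: (homogeneous_eq (oper_eq_compr lA BC)).
have sm i j l U f : open_in U -> smooth_on U f ->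
    smooth_on U (fun x => C i j l * monomial i j l f x).
  by move=> oU sf; apply: smooth_onZ => //;
    exact: lido_smooth (lido_monomial i j l) _ _ oU sf.
pose F (i j l : nat) : oper n := oper_scale (C i j l) (oper_comp A (monomial i j
  l)).
(* The nested abstractions give each inner sum the shape of an operator, as [homogeneous_sum]
   expects. *)
apply: (@homogeneous_eq _ _ (fun f x => \sum_(i < k.+1) (fun f x => \sum_(j < k.+1)
   (fun f x => \sum_(l < k.+1 | (i + j + 2 * l == k)%N) F i j l f x) f x) f x)).
  move=> U f oU sf x Ux; rewrite /oper_comp /form /=.
  rewrite (@lido_sum _ _ A lA U) //; last by move=> i _;
    do 2! apply: smooth_on_sum => // ? _; exact: sm.
  apply: eq_bigr => i _; rewrite (@lido_sum _ _ A lA U) //; last first.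
    by move=> j _; apply: smooth_on_sum => // ? _; exact: sm.
  apply: eq_bigr => j _; rewrite (@lido_sum _ _ A lA U) //; last by move=> l _;
    exact: sm.
  apply: eq_bigr => l _; apply: (lidoZ lA _ oU) => //.
  exact: lido_smooth (lido_monomial i j l) _ _ oU sf.
apply: homogeneous_sum => i _; apply: homogeneous_sum => j _.
apply: homogeneous_sum => l /eqP ijl; apply: homogeneous_scale.
by rewrite -{1}ijl; exact: Amon.
Qed.

Lemma homogeneous_D1 k B : homogeneous k B -> homogeneous (k + 1) (oper_comp D1 B).
Proof.
apply: homogeneous_comp => // i j l.
by have := homogeneous_monomial i.+1 j l; rewrite !addSn addn1.
Qed.

(** Monomials are written in the order [D1], [D2], [Bx]: a new [D2] must be moved past the powers of
    [D1], and below a new [Bx] past those of both. *)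
Lemma homogeneous_D2 k B : homogeneous k B -> homogeneous (k + 1) (oper_comp D2 B).
Proof.
apply: homogeneous_comp => // i j l.
have := homogeneous_monomial i j.+1 l; rewrite addnS addSn addn1.
have lX := lido_exp.
apply: homogeneous_eq; rewrite /monomial.
apply: (@oper_eq_compl _ _ (oper_comp D2 (oper_exp D1 i)) (oper_comp (oper_exp
  D1 i) D2)
   (oper_comp (oper_exp D2 j) (oper_exp Bx l))).
  by apply: lido_comp; exact: lido_exp.
exact: oper_commuteX.
Qed.

Lemma homogeneous_Bx k B : homogeneous k B -> homogeneous (k + 2) (oper_comp Bx B).
Proof.
apply: homogeneous_comp => // i j l.
have := homogeneous_monomial i j l.+1; rewrite mulnS addnCA addnC.
apply: homogeneous_eq; rewrite /monomial.
apply: (@oper_eq_trans _ _ _ (oper_comp (oper_exp D1 i) (oper_comp Bx (oper_comp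
  (oper_exp D2 j) (oper_exp Bx l))))).
  apply: (@oper_eq_compl _ _ (oper_comp Bx (oper_exp D1 i)) (oper_comp (oper_exp
    D1 i) Bx)
     (oper_comp (oper_exp D2 j) (oper_exp Bx l))).
    by apply: lido_comp; exact: lido_exp.
  exact: oper_commuteX.
apply: oper_eq_compr; first exact: lido_exp.
apply: (@oper_eq_compl _ _ (oper_comp Bx (oper_exp D2 j)) (oper_comp (oper_exp
  D2 j) Bx) (oper_exp Bx l)).
  exact: lido_exp.
exact: oper_commuteX.
Qed.

Lemma homogeneous_regular_value k (F : R[i] -> oper n) s0 L :
  (forall s, homogeneous k (F s)) -> regular_value F s0 L -> homogeneous k L.
Proof.
move=> hF [d [P [E [_ lP FP LP]]]].
have [t [c [tE cP]]] := interpolation E s0 (size P).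
apply: (homogeneous_eq LP); apply: homogeneous_scale.
apply: (@homogeneous_eq _ _ (fun f x => \sum_i oper_scale (c i) (oper_scale d.[t
  i] (F (t i))) f x)).
  move=> U f oU sf x Ux; rewrite /oper_scale.
  (* For fixed [f] and [x] this is a scalar polynomial in [s] of size at most [size P], so the same
     nodes and weights serve for all [f] and [x]. *)
  have polyE s : oper_poly P s f x =
      (\poly_(i < size P) nth (@oper_id _ n) P i f x).[s].
    rewrite /oper_poly horner_poly; apply: eq_bigr => i _; exact: mulrC.
  rewrite polyE cP ?size_poly //; apply: eq_bigr => i _; congr (_ * _).
  by rewrite -polyE -(FP _ (tE i) _ _ oU sf).
apply: homogeneous_sum => i _; apply: homogeneous_scale; exact: homogeneous_scale.
Qed.

Lemma lido_Dop p1 p2 q k s : lido (Dop D1 D2 Bx p1 p2 q k s).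
Proof.
have lD : lido (oper_add D1 D2) by exact: lido_add.
move: k s; apply: nat_family_ind2 => [s|s|k IH IH' s]; first exact: lido_id.
  by apply: lido_scale; apply: lido_add; exact: lido_scale.
apply: lido_scale; apply: lido_add.
  by apply: lido_comp; [apply: lido_add; exact: lido_scale|exact: IH'].
apply: lido_scale; apply: lido_comp; last exact: IH.
by apply: lido_add; [exact: lido_exp|exact: lido_scale].
Qed.

(** No value of [s] has to be excluded: at a zero of a denominator the coefficient has a junk value,
    but it is still a constant. *)
Lemma homogeneous_Dop p1 p2 q k s : homogeneous k (Dop D1 D2 Bx p1 p2 q k s).
Proof.
have hD k' B : homogeneous k' B -> homogeneous (k' + 1) (oper_comp (oper_add D1
  D2) B).
  move=> hB; exact: homogeneous_add (homogeneous_D1 hB) (homogeneous_D2 hB).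
have h0 : homogeneous 0 oper_id by exact: (homogeneous_monomial 0 0 0).
move: k s; apply: nat_family_ind2 => [s|s|k IH IH' s]; first exact: h0.
  apply: homogeneous_scale; apply: homogeneous_add; apply: homogeneous_scale.
    exact: (homogeneous_D2 h0).
  exact: (hD _ _ h0).
apply: homogeneous_scale; apply: homogeneous_add.
  rewrite -addn1; apply: homogeneous_comp_addl; apply: homogeneous_comp_scalel.
    exact: homogeneous_D2 (IH' s).
  exact: hD (IH' s).
apply: homogeneous_scale; apply: homogeneous_comp_addl.
  rewrite -addn1 -[k.+1]addn1.
  exact: (hD _ _ (hD _ _ (IH _))).
by apply: homogeneous_comp_scalel; rewrite -addn2; exact: homogeneous_Bx (IH _).
Qed.

Lemma Dop_commute A p1 p2 q k s : lido A -> oper_commute A D1 -> oper_commute A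
  D2 ->
  oper_commute A Bx -> oper_commute A (Dop D1 D2 Bx p1 p2 q k s).
Proof.
move=> lA A1 A2 AB.
have lD : lido (oper_add D1 D2) by exact: lido_add.
have AD : oper_commute A (oper_add D1 D2) by exact: oper_commuteD.
have lE := lido_Dop p1 p2 q.
move: k s; apply: nat_family_ind2 => [s|s|k IH IH' s]; first exact: oper_commute_id.
  apply: oper_commuteZ => //; first by apply: lido_add; exact: lido_scale.
  by apply: oper_commuteD; rewrite //; try exact: lido_scale; exact: oper_commuteZ.
have lQ c : lido (oper_add (oper_exp (oper_add D1 D2) 2) (oper_scale c Bx)).
  by apply: lido_add; [exact: lido_exp|exact: lido_scale].
have lL c c' : lido (oper_add (oper_scale c D2) (oper_scale c' (oper_add D1 D2))).
  by apply: lido_add; exact: lido_scale.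
apply: oper_commuteZ => //.
  apply: lido_add; first by apply: lido_comp; [exact: lL|exact: (lE k.+1)].
  by apply: lido_scale; apply: lido_comp; [exact: lQ|exact: lE].
apply: oper_commuteD => //.
- by apply: lido_comp; [exact: lL|exact: (lE k.+1)].
- by apply: lido_scale; apply: lido_comp; [exact: lQ|exact: lE].
- apply: oper_commuteM => //; [exact: (lE k.+1)| |exact: IH'].
  by apply: oper_commuteD; rewrite //; try exact: lido_scale; exact: oper_commuteZ.
- apply: oper_commuteZ => //; first by apply: lido_comp; [exact: lQ|exact: lE].
  apply: oper_commuteM => //.
  apply: oper_commuteD; rewrite //; try exact: lido_scale.
  + exact: lido_exp.
  + exact: oper_commuteX.
  + exact: oper_commuteZ.
Qed.

End HomogeneousForms.

(** * Complex powers *)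

Section ComplexPowers.
Context {R : realType}.
Implicit Types (r : R) (s t : R[i]).

Lemma cpow0 r : cpow r 0 = 1.
Proof. by rewrite /cpow /= !mul0r expR0 cos0 sin0 mulr1 mulr0. Qed.

Lemma cpowD r s t : cpow r (s + t) = cpow r s * cpow r t.
Proof.
rewrite /cpow; case: s t => [s1 s2] [t1 t2] /=; apply/eqP; rewrite eq_complex /=.
by rewrite !mulrDl expRD cosD sinD; apply/andP; split; apply/eqP; ring.
Qed.

Lemma cpow1 r : 0 < r -> cpow r 1 = r%:C.
Proof. by move=> r0; rewrite /cpow /= mul1r mul0r lnK // cos0 sin0 mulr1 mulr0. Qed.

Lemma cpow_neq0 r s : cpow r s != 0.
Proof.
apply/eqP => rs0; have := cpowD r s (- s); rewrite subrr cpow0 rs0 mul0r.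
by move/eqP; rewrite oner_eq0.
Qed.

Lemma cpowB_nat r s m : 0 < r -> cpow r (s - m%:R) * r%:C ^+ m = cpow r s.
Proof.
move=> r0; elim: m => [|m IHm]; first by rewrite subr0 mulr1.
rewrite exprS mulrA -{1}(cpow1 r0) -cpowD -IHm; congr (cpow r _ * _).
by rewrite -natr1 opprD addrA subrK.
Qed.

End ComplexPowers.

Section DeriveChain.
Context {R : realType} {V : normedModType R}.

Lemma differentiable_comp1 (phi : R -> R) (g : V -> R) a :
  differentiable g a -> derivable phi (g a) 1 -> differentiable (fun b => phi (g
    b)) a.
Proof.
by move=> dg /derivable1_diffP dphi; exact: (@differentiable_comp _ _ _ _ g phi).
Qed.

Lemma derive_comp1 (phi : R -> R) (g : V -> R) a w :
  differentiable g a -> derivable phi (g a) 1 ->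
  'D_w (fun b => phi (g b)) a = derive1 phi (g a) * 'D_w g a.
Proof.
move=> dg dphi.
pose l u := g (a + u *: w).
have l0 : l 0 = g a by rewrite /l scale0r addr0.
have dl : derivable l 0 1.
  have dga : derivable g (a + 0 *: w) w by rewrite scale0r addr0;
    exact: diff_derivable.
  by case: (is_derive_line dga).
have dphi0 : derivable phi (l 0) 1 by rewrite l0.
rewrite -(derive1_line (fun b => phi (g b))) -(derive1_line g) -l0.
exact: (derive1_comp dl dphi0).
Qed.

End DeriveChain.

Section PowersOfFunctions.
Context {R : realType} {V : normedModType R} (U : set V) (k : V -> R).
Hypotheses (oU : open U) (sk : smooth U k) (k_gt0 : forall a, a \in U -> 0 < k a).

Definition pow_re (s : R[i]) a : R := complex.Re (cpow (k a) s).
Definition pow_im (s : R[i]) a : R := complex.Im (cpow (k a) s).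

Let L a := ln (k a).

Let dL a : a \in U -> differentiable L a.
Proof.
move=> aU; apply: differentiable_comp1; first exact: smooth_differentiable sk aU.
by have [] := is_derive1_ln (k_gt0 aU).
Qed.

Let DL a w : a \in U -> 'D_w L a = (k a)^-1 * 'D_w k a.
Proof.
move=> aU; have [dln ln'] := is_derive1_ln (k_gt0 aU).
by rewrite derive_comp1 ?derive1E ?ln' //; exact: smooth_differentiable sk aU.
Qed.

Let dscale c a : a \in U -> differentiable (fun b => c * L b) a.
Proof. by move=> aU; apply: differentiableM;
  [exact: differentiable_cst|exact: dL]. Qed.

Let Dscale c a w : a \in U -> 'D_w (fun b => c * L b) a = c * ((k a)^-1 * 'D_w k a).
Proof.
move=> aU; rewrite -DL // [LHS]deriveM.
- by rewrite derive_cst scaler0 addr0.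
- exact: derivable_cst.
- exact: diff_derivable (dL aU).
Qed.

Let dexp c a : a \in U -> differentiable (fun b => expR (c * L b)) a.
Proof. by move=> aU; apply: differentiable_comp1 => //; exact: dscale. Qed.

Let dcos c a : a \in U -> differentiable (fun b => cos (c * L b)) a.
Proof. by move=> aU; apply: differentiable_comp1 => //; exact: dscale. Qed.

Let dsin c a : a \in U -> differentiable (fun b => sin (c * L b)) a.
Proof. by move=> aU; apply: differentiable_comp1 => //; exact: dscale. Qed.

Let Dexp c a w : a \in U -> 'D_w (fun b => expR (c * L b)) a =
  expR (c * L a) * (c * ((k a)^-1 * 'D_w k a)).
Proof.
move=> aU; rewrite (derive_comp1 w (dscale c aU)) // Dscale // derive1E.
by rewrite derive_val.
Qed.

Let Dcos c a w : a \in U -> 'D_w (fun b => cos (c * L b)) a =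
  - sin (c * L a) * (c * ((k a)^-1 * 'D_w k a)).
Proof.
move=> aU; rewrite (derive_comp1 w (dscale c aU)) // Dscale // derive1E.
by rewrite derive_val.
Qed.

Let Dsin c a w : a \in U -> 'D_w (fun b => sin (c * L b)) a =
  cos (c * L a) * (c * ((k a)^-1 * 'D_w k a)).
Proof.
move=> aU; rewrite (derive_comp1 w (dscale c aU)) // Dscale // derive1E.
by rewrite derive_val.
Qed.

(** This is the real part of [s k^s ('D_w k / k)]; the next lemma is the imaginary part. *)
Lemma derive_pow_re s a w : a \in U -> 'D_w (pow_re s) a =
  (complex.Re s * pow_re s a - complex.Im s * pow_im s a) * ((k a)^-1 * 'D_w k a).
Proof.
move=> aU; have d1 : derivable (fun b => expR (complex.Re s * L b)) a w.
  exact: diff_derivable (dexp _ aU).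
have d2 : derivable (fun b => cos (complex.Im s * L b)) a w.
  exact: diff_derivable (dcos _ aU).
rewrite [LHS](deriveM d1 d2).
rewrite Dexp // Dcos // /pow_re /pow_im /cpow /= -/(L a) /GRing.scale /=; ring.
Qed.

Lemma derive_pow_im s a w : a \in U -> 'D_w (pow_im s) a =
  (complex.Im s * pow_re s a + complex.Re s * pow_im s a) * ((k a)^-1 * 'D_w k a).
Proof.
move=> aU; have d1 : derivable (fun b => expR (complex.Re s * L b)) a w.
  exact: diff_derivable (dexp _ aU).
have d2 : derivable (fun b => sin (complex.Im s * L b)) a w.
  exact: diff_derivable (dsin _ aU).
rewrite [LHS](deriveM d1 d2).
rewrite Dexp // Dsin // /pow_re /pow_im /cpow /= -/(L a) /GRing.scale /=; ring.
Qed.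

(** The derivatives of [pow_re] and [pow_im] involve each other and [1 / k], whose derivative is
    [- (1 / k)^2 'D_w k]; with smooth functions added, the generated algebra is stable under
    differentiation. *)
Inductive pow_generator s : (V -> R) -> Prop :=
| pg_smooth g : smooth U g -> pow_generator s g
| pg_re : pow_generator s (pow_re s)
| pg_im : pow_generator s (pow_im s)
| pg_inv : pow_generator s (fun a => (k a)^-1).

Lemma smooth_pow_generator s g : algebra_gen (pow_generator s) g -> smooth U g.
Proof.
have unit_k a : a \in U -> k a != 0 by move=> aU; rewrite gt_eqF // k_gt0.
have dk a : a \in U -> differentiable k a by exact: smooth_differentiable.
apply: smooth_algebra_gen => // {}g.
  move=> a [{}g sg| | |] aU.
  - exact: smooth_differentiable sg aU.
  - by apply: differentiableM; [exact: dexp|exact: dcos].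
  - by apply: differentiableM; [exact: dexp|exact: dsin].
  - by apply: differentiableV; [exact: dk|exact: unit_k].
have sDk w : algebra_gen (pow_generator s) ('D_w k).
  by apply: alg_gen; apply: pg_smooth; exact: smooth_derive.
have inv_gen : algebra_gen (pow_generator s) (fun a => (k a)^-1).
  by apply: alg_gen; exact: pg_inv.
have re_gen : algebra_gen (pow_generator s) (pow_re s) by apply: alg_gen;
  exact: pg_re.
have im_gen : algebra_gen (pow_generator s) (pow_im s) by apply: alg_gen;
  exact: pg_im.
have cst_gen c : algebra_gen (pow_generator s) (fun=> c) by exact: alg_cst.
move=> w [{}g sg| | |].
- by exists ('D_w g) => //; apply: alg_gen; apply: pg_smooth; exact: smooth_derive.
- exists (fun a => (complex.Re s * pow_re s a + - complex.Im s * pow_im s a) *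
    ((k a)^-1 * 'D_w k a)).
    apply: alg_mul; last exact: alg_mul.
    by apply: alg_add; apply: alg_mul.
  by move=> a aU; rewrite derive_pow_re // mulNr.
- exists (fun a => (complex.Im s * pow_re s a + complex.Re s * pow_im s a) *
    ((k a)^-1 * 'D_w k a)).
    apply: alg_mul; last exact: alg_mul.
    by apply: alg_add; apply: alg_mul.
  by move=> a aU; rewrite derive_pow_im.
- exists (fun a => -1 * ((k a)^-1 * (k a)^-1) * 'D_w k a).
    by apply: alg_mul => //; apply: alg_mul => //; exact: alg_mul.
  move=> a aU; rewrite [LHS]deriveV ?unit_k //; last exact: smooth_derivable sk aU.
  by rewrite /GRing.scale /= mulN1r expr2 invfM.
Qed.

Lemma smooth_pow_re s : smooth U (pow_re s).
Proof. by apply: (@smooth_pow_generator s); apply: alg_gen; exact: pg_re. Qed.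

Lemma smooth_pow_im s : smooth U (pow_im s).
Proof. by apply: (@smooth_pow_generator s); apply: alg_gen; exact: pg_im. Qed.

End PowersOfFunctions.

Section VfieldPowers.
Context {R : realType} {n : htypeAlg R} (U : set n) (k : n -> R).
Local Notation chart U := (@of_coord R n @^-1` U).
Hypotheses (oU : open_in U) (sk : smooth (chart U) (fun a => k (of_coord a)))
  (k_gt0 : forall x, U x -> 0 < k x).

Let kc_gt0 a : a \in chart U -> 0 < k (of_coord a).
Proof. by rewrite in_setE => /k_gt0. Qed.

Lemma smooth_on_cpow s : smooth_on U (fun x => cpow (k x) s).
Proof.
by split; [exact: (smooth_pow_re oU sk kc_gt0)|exact: (smooth_pow_im oU sk kc_gt0)].
Qed.

Lemma vfield_cpow S s x : U x -> vfield S (fun y => cpow (k y) s) x =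
  s * cpow (k x) (s - 1) * vfield S (fun y => (k y)%:C) x.
Proof.
move=> Ux; have xU := chart_in Ux; have k0 := k_gt0 Ux.
have -> : cpow (k x) (s - 1) = cpow (k x) s * ((k x)^-1)%:C.
  rewrite -{1}(cpowB_nat s 1 k0) expr1 -mulrA -rmorphM /= divff ?gt_eqF //.
  by rewrite mulr1.
rewrite !vfield_to_coord /real_field.
set v := field_vec S (to_coord x).
have -> : 'D_v (im_coord (fun y => (k y)%:C)) (to_coord x) = 0.
  exact: derive_cst.
have -> : 'D_v (re_coord (fun y => cpow (k y) s)) (to_coord x) = _ :=
  derive_pow_re sk kc_gt0 s v xU.
have -> : 'D_v (im_coord (fun y => cpow (k y) s)) (to_coord x) = _ :=
  derive_pow_im sk kc_gt0 s v xU.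
rewrite /pow_re /pow_im !to_coordK -[re_coord _]/(fun a => k (of_coord a)).
move: ('D_v _ _) => D; case: (cpow (k x) s) => [a b]; case: (s) => [c d] /=.
by apply/eqP; rewrite eq_complex /=; apply/andP; split; apply/eqP; ring.
Qed.

End VfieldPowers.

(** * Sums of squares of vector fields *)

Section SecondOrder.
Context {R : realType} {n : htypeAlg R} (U : set n).
Hypothesis oU : open_in U.
Implicit Types (r : seq n) (f g h : n -> R[i]).

(* The carre du champ of the operator [sum_squares r]. *)
Definition gam r f g (x : n) : R[i] := \sum_(S <- r) vfield S f x * vfield S g x.

Lemma gamC r f g x : gam r f g x = gam r g f x.
Proof. by apply: eq_bigr => S _; rewrite mulrC. Qed.

Lemma gamDr r f g h x : smooth_on U g -> smooth_on U h -> U x ->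
  gam r f (fun y => g y + h y) x = gam r f g x + gam r f h x.
Proof.
move=> sg sh Ux; rewrite /gam -big_split; apply: eq_bigr => S _.
by rewrite (vfieldD S oU sg sh Ux) mulrDr.
Qed.

Lemma vfieldX S f m x : smooth_on U f -> U x ->
  vfield S (fun y => f y ^+ m) x = m%:R * f x ^+ m.-1 * vfield S f x.
Proof.
move=> sf Ux; elim: m => [|m IHm]; first by rewrite vfield_cst !mul0r.
rewrite (vfield_local (g := fun y => f y * f y ^+ m) S oU _ Ux); last first.
  by move=> y _; rewrite exprS.
rewrite (vfieldM S oU sf (smooth_onX m oU sf) Ux) IHm -natr1 /=.
by case: m {IHm} => [|m]; rewrite ?expr0 ?exprS /=; ring.
Qed.

Lemma gamXr r f g m x : smooth_on U g -> U x ->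
  gam r f (fun y => g y ^+ m) x = m%:R * g x ^+ m.-1 * gam r f g x.
Proof.
move=> sg Ux; rewrite /gam mulr_sumr; apply: eq_bigr => S _.
by rewrite (vfieldX S m sg Ux); ring.
Qed.

Lemma sum_squaresM r f g x : smooth_on U f -> smooth_on U g -> U x ->
  sum_squares r (fun y => f y * g y) x =
  sum_squares r f x * g x + f x * sum_squares r g x + 2 * gam r f g x.
Proof.
move=> sf sg Ux; rewrite /sum_squares /gam mulr_suml !mulr_sumr -!big_split.
apply: eq_bigr => S _ /=.
have sVf := smooth_on_vfield S oU sf; have sVg := smooth_on_vfield S oU sg.
rewrite (vfield_local (g := fun y => vfield S f y * g y + f y * vfield S g y) S
  oU _ Ux).
  rewrite (vfieldD S oU (smooth_onM oU sVf sg) (smooth_onM oU sf sVg) Ux).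
  rewrite (vfieldM S oU sVf sg Ux) (vfieldM S oU sf sVg Ux).
  move: (vfield S (vfield S f) x) (vfield S (vfield S g) x) (vfield S f x).
  by move: (vfield S g x) (f x) (g x) => *; ring.
by move=> y Uy; exact: vfieldM sf sg Uy.
Qed.

Lemma sum_squares_local r f g : (forall x, U x -> f x = g x) ->
  forall x, U x -> sum_squares r f x = sum_squares r g x.
Proof. by move=> fg x Ux;
  exact: lido_local (lido_sum_squares r) _ _ _ oU fg _ Ux. Qed.

Lemma sum_squaresD r f g x : smooth_on U f -> smooth_on U g -> U x ->
  sum_squares r (fun y => f y + g y) x = sum_squares r f x + sum_squares r g x.
Proof. by move=> sf sg Ux;
  exact: lidoD (lido_sum_squares r) _ _ _ oU sf sg _ Ux. Qed.

Lemma sum_squares_cst r c x : U x -> sum_squares r (fun=> c) x = 0.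
Proof.
move=> Ux; rewrite /sum_squares big1 // => S _.
by rewrite (vfield_local (g := fun=> 0) S oU _ Ux) ?vfield_cst // => y _;
  exact: vfield_cst.
Qed.

(** Where a predecessor is truncated, for [m = 0] or [m = 1], its coefficient [m] or [m * m.-1] is
    zero. *)
Lemma sum_squaresX r f m x : smooth_on U f -> U x ->
  sum_squares r (fun y => f y ^+ m) x =
  m%:R * f x ^+ m.-1 * sum_squares r f x + (m * m.-1)%:R * f x ^+ m.-2 * gam r f
    f x.
Proof.
move=> sf Ux; elim: m => [|m IHm].
  by rewrite sum_squares_cst // !mul0r addr0.
rewrite (@sum_squares_local r _ (fun y => f y * f y ^+ m) _ _ Ux); last first.
  by move=> y _; rewrite exprS.
rewrite (sum_squaresM r sf (smooth_onX m oU sf) Ux) IHm (gamXr r f m sf Ux) /=.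
case: m {IHm} => [|[|m]] /=;
  rewrite ?expr0 ?expr1 ?mul0n ?muln0 ?mul1r ?mul0r //=; first by ring.
  by rewrite muln1; ring.
rewrite !exprS !natrM -!natr1; ring.
Qed.

Section Powers.
Variables (k : n -> R).
Hypotheses (sk : smooth (@of_coord R n @^-1` U) (fun a => k (of_coord a)))
  (k_gt0 : forall x, U x -> 0 < k x).
Let kc x : R[i] := (k x)%:C.

Lemma gam_cpow r f s x : U x -> gam r f (fun y => cpow (k y) s) x =
  s * cpow (k x) (s - 1) * gam r f kc x.
Proof.
move=> Ux; rewrite /gam mulr_sumr; apply: eq_bigr => S _.
by rewrite (vfield_cpow sk k_gt0 S s Ux) /kc mulrCA.
Qed.

(** The second-order chain rule [L phi(k) = phi'(k) L k + phi''(k) gam(k, k)] for a power function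
    [phi]. *)
Lemma sum_squares_cpow r s x : U x -> sum_squares r (fun y => cpow (k y) s) x =
  s * cpow (k x) (s - 1) * sum_squares r kc x +
  s * (s - 1) * cpow (k x) (s - 2) * gam r kc kc x.
Proof.
move=> Ux; have sC s' := smooth_on_cpow oU sk k_gt0 s'.
have skc : smooth_on U kc by exact: smooth_on_real.
rewrite /sum_squares /gam !mulr_sumr -big_split; apply: eq_bigr => S _ /=.
rewrite (vfield_local (g := fun y => s * (cpow (k y) (s - 1) * vfield S kc y)) S
  oU _ Ux).
  have sV := smooth_on_vfield S oU skc.
  rewrite (vfieldZ S s oU (smooth_onM oU (sC _) sV) Ux).
  rewrite (vfieldM S oU (sC _) sV Ux) (vfield_cpow sk k_gt0 S _ Ux).
  rewrite -/kc -[s - 1 - 1]addrA -opprD.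
  by move: (vfield S (vfield S kc) x) (vfield S kc x) (cpow _ _) (cpow _ _) =>
    *; ring.
by move=> y Uy; rewrite (vfield_cpow sk k_gt0 S s Uy) mulrA.
Qed.

End Powers.
End SecondOrder.

(** * Orthonormal bases and squared norms of components as quadratic functions *)

Section Table.
Context {R : realType} {n : htypeAlg R}.
Notation ip := (@ht_ip R n).
Notation br := (@ht_br R n).

Lemma ip_linr x : scalar (ip x). Proof. by case: (ht_ipP n). Qed.
Lemma ipC x y : ip x y = ip y x. Proof. by case: (ht_ipP n). Qed.
Lemma ipDr x y w : ip x (y + w) = ip x y + ip x w.
Proof. exact: (linD (ip_linr x : linear _)). Qed.
Lemma ipDl x y w : ip (x + y) w = ip x w + ip y w.
Proof. by rewrite ipC ipDr ![ip w _]ipC. Qed.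
Lemma ipZr c x y : ip x (c *: y) = c * ip x y.
Proof. exact: (linZ (ip_linr x : linear _)). Qed.
Lemma ipZl c x y : ip (c *: x) y = c * ip x y.
Proof. by rewrite ipC ipZr ipC. Qed.
Lemma ip0r x : ip x 0 = 0. Proof. exact: (lin0 (ip_linr x : linear _)). Qed.
Lemma ipNr x y : ip x (- y) = - ip x y. Proof. by rewrite -scaleN1r ipZr mulN1r.
  Qed.
Lemma ip_sumr (I : Type) (r : seq I) (P : pred I) F x :
  ip x (\sum_(i <- r | P i) F i) = \sum_(i <- r | P i) ip x (F i).
Proof. exact: (linsum (ip_linr x : linear _)). Qed.
Lemma ip_eq0 x : ip x x = 0 -> x = 0.
Proof.
by move=> xx; apply/eqP; apply: contraT => /(let: And3 _ _ p := ht_ipP n in p);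
  rewrite xx ltxx.
Qed.
Lemma ip_ge0 x : 0 <= ip x x.
Proof.
have [->|] := eqVneq x 0; first by rewrite ip0r.
by move/(let: And3 _ _ p := ht_ipP n in p)/ltW.
Qed.
Lemma sqr_ip_norm x : ip_norm ip x ^+ 2 = ip x x.
Proof. by rewrite /ip_norm sqr_sqrtr // ip_ge0. Qed.

Lemma orthonormal_expand (W : {vspace n}) r w : orthonormal_basis ip W r -> w
  \in W ->
  w = \sum_(S <- r) ip S w *: S.
Proof.
move=> [rW ron] wW.
have wE := coord_basis (X := in_tuple r) rW wW.
rewrite {1}wE (big_nth 0) big_mkord; apply: eq_bigr => i _; congr (_ *: _).
rewrite {2}wE ip_sumr (bigD1 i) //= ipZr ron // eqxx mulr1 big1 ?addr0 // => j ji.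
by rewrite ipZr ron // eq_sym (negbTE (_ : (j != i :> nat))) ?mulr0.
Qed.

Lemma parseval (W : {vspace n}) r x w : orthonormal_basis ip W r -> w \in W ->
  \sum_(S <- r) ip S x * ip S w = ip x w.
Proof.
move=> rW wW; rewrite {2}(orthonormal_expand rW wW) ip_sumr.
by apply: eq_bigr => S _; rewrite ipZr mulrC (ipC x).
Qed.

Lemma orthonormal_mem (W : {vspace n}) r S : orthonormal_basis ip W r -> S \in r
  -> S \in W.
Proof. by move=> [rW _] Sr; exact: (basis_mem rW). Qed.

Lemma orthonormal_norm (W : {vspace n}) r S : orthonormal_basis ip W r -> S \in
  r -> ip S S = 1.
Proof. by move=> [_ ron] /(nthP 0)[i ir <-]; rewrite ron // eqxx. Qed.

Lemma orthonormal_size (W : {vspace n}) r : orthonormal_basis ip W r -> size r =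
  \dim W.
Proof. by move=> [rW _]; rewrite (size_basis (X := in_tuple r) rW). Qed.

Lemma open_in_setT : open_in (setT : set n).
Proof. by rewrite /open_in preimage_setT; exact: openT. Qed.

Lemma smooth_on_scalar U (l : n -> R) : open_in U -> scalar l ->
  smooth_on U (fun x => (l x)%:C).
Proof. by move=> oU ll; apply: smooth_on_real => //; exact: smooth_linear. Qed.

Lemma vfield_scalar S (l : n -> R) x : scalar l ->
  vfield S (fun y => (l y)%:C) x = (l (field_dir S x))%:C.
Proof.
move=> ll; rewrite vfield_to_coord /real_field.
have -> : 'D_(field_vec S (to_coord x)) (im_coord (fun y => (l y)%:C)) (to_coord
  x) = 0.
  exact: derive_cst.
have -> : 'D_(field_vec S (to_coord x)) (re_coord (fun y => (l y)%:C)) (to_coord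
  x) = _ :=
  derive_linear _ _ ll.
by rewrite /field_vec !to_coordK.
Qed.

Lemma smooth_quad U (I : Type) (r : seq I) (l m : I -> n -> R) : open_in U ->
  (forall i, scalar (l i)) -> (forall i, scalar (m i)) ->
  smooth (@of_coord R n @^-1` U) (fun a => \sum_(i <- r) l i (of_coord a) * m i
    (of_coord a)).
Proof.
move=> oU ll lm; apply: smooth_sum => // i; apply: smoothM => //;
  exact: smooth_linear.
Qed.

Lemma vfield_quad (I : Type) (r : seq I) (l m : I -> n -> R) S x :
  (forall i, scalar (l i)) -> (forall i, scalar (m i)) ->
  vfield S (fun y => (\sum_(i <- r) l i y * m i y)%:C) x =
  (\sum_(i <- r) (l i (field_dir S x) * m i x + l i x * m i (field_dir S x)))%:C.
Proof.
move=> ll lm; have oT := open_in_setT.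
have sl i : smooth_on setT (fun x => (l i x)%:C) by exact: smooth_on_scalar.
have sm i : smooth_on setT (fun x => (m i x)%:C) by exact: smooth_on_scalar.
elim: r => [|i r IHr].
  rewrite big_nil (vfield_local (g := fun=> 0) S oT) ?vfield_cst // => y _.
  by rewrite big_nil.
rewrite (vfield_local (U := setT) (g := fun y => (l i y)%:C * (m i y)%:C +
  (\sum_(i <- r) l i y * m i y)%:C) S oT) //.
  rewrite (vfieldD (U := setT) S oT) //; last 2 first.
  - exact: smooth_onM.
  - by apply: smooth_on_real => //; exact: smooth_quad.
  rewrite (vfieldM (U := setT) S oT) // IHr !vfield_scalar //.
  by rewrite big_cons !rmorphD !rmorphM.
by move=> y _; rewrite big_cons rmorphD rmorphM.
Qed.

(** For [r] an orthonormal basis of v_1, v_2 or z this is |X_1|^2, |X_2|^2 or |Z|^2. As a sum of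
    products of linear forms it is differentiated by [vfield_quad], without any projection. *)
Definition quad (r : seq n) x : R := \sum_(S <- r) ip S x * ip S x.
Definition cquad r x : R[i] := (quad r x)%:C.

Lemma quad_ge0 r x : 0 <= quad r x.
Proof. by apply: sumr_ge0 => S _; rewrite -expr2 sqr_ge0. Qed.

Lemma smooth_on_cquad U r : open_in U -> smooth_on U (cquad r).
Proof. by move=> oU; apply: smooth_on_real => //; apply: smooth_quad => // i;
  exact: ip_linr. Qed.

(** The hypotheses make [d] the orthogonal projection of [field_dir S x] to [W]; the formula is
    Parseval applied to [x] and [d]. *)
Lemma vfield_cquad (W : {vspace n}) r S x d : orthonormal_basis ip W r -> d \in W ->
  (forall w, w \in W -> ip w (field_dir S x) = ip w d) ->
  vfield S (cquad r) x = (2 * ip x d)%:C.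
Proof.
move=> rW dW dP; rewrite /cquad /quad vfield_quad; try by move=> i; exact: ip_linr.
congr (_%:C); rewrite -(parseval x rW dW) mulr_sumr; apply: eq_big_seq => S' S'r.
by rewrite (dP _ (orthonormal_mem rW S'r)); ring.
Qed.

End Table.

(** * The H-type condition *)

Section HType.
Context {R : realType} {n : htypeAlg R} (W W' : {vspace n}) (r r' t : seq n).
Notation ip := (@ht_ip R n).
Notation br := (@ht_br R n).
Notation z := (ht_z n).
Hypotheses (WW' : (W + W')%VS = ht_v n) (oW : orthogonal_spaces ip W W')
  (bW : bracket_space br W W' = 0%VS).
Hypotheses (rW : orthonormal_basis ip W r) (rW' : orthonormal_basis ip W' r')
  (tz : orthonormal_basis ip z t).

Let Wv x : x \in W -> x \in ht_v n.
Proof. by rewrite -WW'; apply: (subvP (addvSl _ _)). Qed.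
Let W'v x : x \in W' -> x \in ht_v n.
Proof. by rewrite -WW'; apply: (subvP (addvSr _ _)). Qed.

Let brWW' x y : x \in W -> y \in W' -> br x y = 0.
Proof.
move=> xW yW'; apply/eqP; rewrite -memv0 -bW.
by apply: mem_bracket_space => //; exact: ht_brP.
Qed.

Let v_dec x : x \in ht_v n -> exists2 x1, x1 \in W & exists2 x2, x2 \in W' & x =
  x1 + x2.
Proof. by rewrite -WW' => /memv_addP[x1 x1W [x2 x2W ->]]; exists x1 => //;
  exists x2. Qed.

Lemma ip_vz x y : x \in ht_v n -> y \in z -> ip x y = 0.
Proof. by move=> xv yz; apply: ht_orth. Qed.

Lemma htype_dec x : exists x1 x2 x3,
  [/\ x1 \in W, x2 \in W', x3 \in z & x = x1 + x2 + x3].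
Proof.
have [u /v_dec[x1 x1W [x2 x2W ->]] [w wz ->]] := full_dec x.
by exists x1, x2, w.
Qed.

Lemma quad_dec x1 x2 x3 : x1 \in W -> x2 \in W' -> x3 \in z ->
  [/\ quad r (x1 + x2 + x3) = ip x1 x1, quad r' (x1 + x2 + x3) = ip x2 x2 &
      quad t (x1 + x2 + x3) = ip x3 x3].
Proof.
move=> x1W x2W x3z; split.
- rewrite -(parseval _ rW x1W); apply: eq_big_seq => S /(orthonormal_mem rW) SW.
  by rewrite !ipDr (oW SW x2W) (ip_vz (Wv SW) x3z) !addr0.
- rewrite -(parseval _ rW' x2W); apply: eq_big_seq => S /(orthonormal_mem rW') SW.
  by rewrite !ipDr (ipC S x1) (oW x1W SW) (ip_vz (W'v SW) x3z) addr0 add0r.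
- rewrite -(parseval _ tz x3z); apply: eq_big_seq => S /(orthonormal_mem tz) Sz.
  by rewrite !ipDr !(ipC S) (ip_vz (Wv x1W) Sz) (ip_vz (W'v x2W) Sz) !add0r.
Qed.

(** On [W] the form [S |-> <Z, [x, S]>] is the inner product with [y = J_Z x1], where [x1] is the
    [W] component of [x]. As [y] lies in [W], Parseval turns the sum into
    [<y, y> = - <J_Z (J_Z x1), x1>], and the H-type condition gives 16. *)
Lemma sum_sqr_ip_br Z x : Z \in z ->
  \sum_(S <- r) ip Z (br x S) ^+ 2 = 16 * ip Z Z * quad r x.
Proof.
move=> Zz; have [x1 [x2 [x3 [x1W x2W x3z xE]]]] := htype_dec x.
have -> : quad r x = ip x1 x1 by rewrite xE; case: (quad_dec x1W x2W x3z).
have [J HJ J2] := ht_J n.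
have [yv yP] := HJ Z x1 Zz (Wv x1W).
set y := J Z x1 in yv yP.
(* The [W'] component [y2] satisfies [<y2, y2> = <y, y2> = <Z, [x1, y2]> = 0], as [W] and [W']
   commute. *)
have yW : y \in W.
  have [y1 y1W [y2 y2W yE]] := v_dec yv.
  suff y20 : y2 = 0 by rewrite yE y20 addr0.
  apply: ip_eq0; have : ip y y2 = 0 by rewrite yP ?W'v // brWW' // ip0r.
  by rewrite {1}yE ipDl (oW y1W y2W) add0r.
have yE S : S \in W -> ip Z (br x S) = ip S y.
  move=> SW; rewrite ipC [RHS]ipC yP ?Wv // ipC xE !(brDl (ht_brP n)).
  rewrite (br_central _ x3z) (br_anti (ht_brP n) x2) (brWW' SW x2W).
  by rewrite oppr0 !addr0.
rewrite (eq_big_seq (fun S => ip S y * ip S y)); last first.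
  by move=> S /(orthonormal_mem rW) SW; rewrite yE // expr2.
rewrite (parseval _ rW yW) yP ?Wv // (br_anti (ht_brP n)) ipNr.
have [_ JyP] := HJ Z y Zz (Wv yW).
rewrite -JyP ?Wv // J2 ?Wv // ipZl sqr_ip_norm; ring.
Qed.

Lemma vfield_cquad_same S x : S \in W -> vfield S (cquad r) x = (2 * ip x S)%:C.
Proof.
move=> SW; apply: (vfield_cquad rW SW) => w wW.
by rewrite ipDr ipZr (ip_vz (Wv wW) (br_mem_z _ _)) mulr0 addr0.
Qed.

Lemma vfield_cquad_other S x : S \in W -> vfield S (cquad r') x = 0.
Proof.
move=> SW; rewrite (vfield_cquad (d := 0) rW') ?mem0v ?ip0r ?mulr0 // => w wW.
by rewrite ipDr ipZr (ip_vz (W'v wW) (br_mem_z _ _)) mulr0 addr0 ip0r ipC oW.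
Qed.

Lemma vfield_cquad_z S x : S \in W -> vfield S (cquad t) x = (ip x (br x S))%:C.
Proof.
move=> SW; rewrite (vfield_cquad (d := 2^-1 *: br x S) tz).
- by rewrite ipZr mulrA divff ?pnatr_eq0 // mul1r.
- by apply: memvZ; exact: br_mem_z.
- by move=> w wz; rewrite ipDr ipC (ip_vz (Wv SW) wz) add0r.
Qed.

Lemma vfield_z_cquad S x : S \in z -> vfield S (cquad r) x = 0.
Proof.
move=> Sz; rewrite (vfield_cquad (d := 0) rW) ?mem0v ?ip0r ?mulr0 // => w wW.
by rewrite /field_dir br_center // scaler0 addr0 ip0r (ip_vz (Wv wW)).
Qed.

Lemma vfield_z_cquad_z S x : S \in z -> vfield S (cquad t) x = (2 * ip x S)%:C.
Proof.
move=> Sz; apply: (vfield_cquad tz Sz) => w wz.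
by rewrite /field_dir br_center // scaler0 addr0.
Qed.

Lemma vfield2_cquad_same S x : S \in W -> vfield S (vfield S (cquad r)) x =
  (2 * ip S S)%:C.
Proof.
move=> SW; have -> : vfield S (cquad r) = fun y => (2 * ip S y)%:C.
  by apply/funext => y; rewrite vfield_cquad_same // (ipC S).
have l2 : scalar (fun y => 2 * ip S y).
  by move=> c u w; rewrite ipDr ipZr mulrDr mulrCA.
rewrite (vfield_scalar S x l2) ipDr ipZr.
by rewrite (ip_vz (Wv SW) (br_mem_z _ _)) mulr0 addr0.
Qed.

Lemma vfield2_z_cquad_z S x : S \in z -> vfield S (vfield S (cquad t)) x =
  (2 * ip S S)%:C.
Proof.
move=> Sz; have -> : vfield S (cquad t) = fun y => (2 * ip S y)%:C.
  by apply/funext => y; rewrite vfield_z_cquad_z // (ipC S).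
have l2 : scalar (fun y => 2 * ip S y).
  by move=> c u w; rewrite ipDr ipZr mulrDr mulrCA.
by rewrite (vfield_scalar S x l2) /field_dir br_center // scaler0 addr0.
Qed.

(** In the product [<T, y> <T, [y, S]>] the second factor is constant along the field, since [[S +
    [x, S] / 2, S] = 0]. Only the first factor contributes, with the 1/2 of the group law. *)
Lemma vfield2_cquad_z S x : S \in W -> vfield S (vfield S (cquad t)) x =
  (2^-1 * \sum_(T <- t) ip T (br x S) ^+ 2)%:C.
Proof.
move=> SW.
have -> : vfield S (cquad t) = fun y => (\sum_(T <- t) ip T y * ip T (br y S))%:C.
  apply/funext => y; rewrite vfield_cquad_z //; congr (_%:C).
  by rewrite (parseval _ tz (br_mem_z _ _)).
rewrite vfield_quad; last 2 first.
- by move=> T; exact: ip_linr.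
- by move=> T c u w; rewrite (brDl (ht_brP n)) (brZl (ht_brP n)) ipDr ipZr.
congr (_%:C); rewrite mulr_sumr; apply: eq_big_seq => T /(orthonormal_mem tz) Tz.
have [_ _ alt _] := ht_brP n.
rewrite (brDl (ht_brP n)) (brZl (ht_brP n)) alt (br_central _ (br_mem_z _ _)).
rewrite scaler0 addr0 ip0r mulr0 addr0 ipDr (ipC T S) (ip_vz (Wv SW) Tz) add0r ipZr.
by rewrite -mulrA expr2.
Qed.

Let sumC (I : Type) (s : seq I) (F : I -> R) :
  (\sum_(i <- s) F i)%:C = \sum_(i <- s) (F i)%:C :> R[i].
Proof. exact: (rmorph_sum (real_complex R)). Qed.

Lemma gam_cquad_same x : gam r (cquad r) (cquad r) x = 4 * cquad r x.
Proof.
rewrite /gam /cquad /quad sumC mulr_sumr;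
  apply: eq_big_seq => S /(orthonormal_mem rW) SW.
by rewrite vfield_cquad_same // (ipC S) !rmorphM rmorph_nat; ring.
Qed.

Lemma gam_cquad_other f x : gam r f (cquad r') x = 0.
Proof.
rewrite /gam big_seq big1 // => S /(orthonormal_mem rW) SW.
by rewrite vfield_cquad_other // mulr0.
Qed.

(** Putting the coefficient [<S, x1>] inside the bracket reassembles [x1]: the sum is [2 <x,
    [x, x1]>], and [[x, x1] = 0] because [W'] commutes with [W] and z is central. *)
Lemma gam_cquad_z x : gam r (cquad r) (cquad t) x = 0.
Proof.
have [x1 [x2 [x3 [x1W x2W x3z xE]]]] := htype_dec x.
rewrite /gam (eq_big_seq (fun S => (2 * ip x (br x (ip S x1 *: S)))%:C));
  last first.
  move=> S /(orthonormal_mem rW) SW; rewrite vfield_cquad_same // vfield_cquad_z //.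
  rewrite -rmorphM (brZr (ht_brP n)) ipZr; congr (_%:C).
  have -> : ip S x1 = ip x S; last by ring.
  by rewrite xE (ipC _ S) !ipDr (oW SW x2W) (ip_vz (Wv SW) x3z) !addr0.
rewrite -sumC -mulr_sumr -ip_sumr -(linsum (br_linr (ht_brP n) x)).
rewrite -(orthonormal_expand rW x1W) xE !(brDl (ht_brP n)).
have [_ _ alt _] := ht_brP n.
rewrite alt (br_central _ x3z) (br_anti (ht_brP n) x2) (brWW' x1W x2W).
by rewrite oppr0 !addr0 ip0r mulr0.
Qed.

Lemma gam_cquad_zz x : gam r (cquad t) (cquad t) x = 16 * cquad t x * cquad r x.
Proof.
have [x1 [x2 [x3 [x1W x2W x3z xE]]]] := htype_dec x.
have tE : quad t x = ip x3 x3 by rewrite xE; case: (quad_dec x1W x2W x3z).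
rewrite /gam (eq_big_seq (fun S => (ip x3 (br x S) ^+ 2)%:C)); last first.
  move=> S /(orthonormal_mem rW) SW; rewrite vfield_cquad_z // -rmorphM -expr2.
  congr (_%:C); congr (_ ^+ 2); rewrite {1}xE !ipDl.
  by rewrite (ip_vz (Wv x1W) (br_mem_z _ _)) (ip_vz (W'v x2W) (br_mem_z _ _))
    !add0r.
by rewrite -sumC sum_sqr_ip_br // -tE /cquad !rmorphM rmorph_nat.
Qed.

Lemma sum_squares_cquad_same x : sum_squares r (cquad r) x = (2 * \dim W)%:R.
Proof.
rewrite /sum_squares (eq_big_seq (fun=> 2)); last first.
  move=> S Sr; rewrite vfield2_cquad_same ?(orthonormal_mem rW) //.
  by rewrite (orthonormal_norm rW Sr) mulr1 rmorph_nat.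
by rewrite big_const_seq count_predT iter_addr_0 (orthonormal_size rW) natrM
  mulr_natr.
Qed.

Lemma sum_squares_cquad_other x : sum_squares r (cquad r') x = 0.
Proof.
rewrite /sum_squares big_seq big1 // => S /(orthonormal_mem rW) SW.
have -> : vfield S (cquad r') = fun=> 0; last exact: vfield_cst.
by apply/funext => y; exact: vfield_cquad_other.
Qed.

Lemma sum_squares_cquad_z x : sum_squares r (cquad t) x = 8 * (\dim z)%:R *
  cquad r x.
Proof.
rewrite /sum_squares (eq_big_seq (fun S => (2^-1 * \sum_(T <- t) ip T (br x S)
  ^+ 2)%:C)).
  (* After the exchange, [sum_sqr_ip_br] applies to each unit vector [T] of z; the constant 8 is 16
     times the 1/2 of the second derivative. *)
  rewrite -sumC -mulr_sumr exchange_big /= (eq_big_seq (fun=> 16 * quad r x));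
    last first.
    move=> T Tt; rewrite sum_sqr_ip_br ?(orthonormal_mem tz) //.
    by rewrite (orthonormal_norm tz Tt) mulr1.
  rewrite big_const_seq count_predT iter_addr_0 (orthonormal_size tz).
  have -> : 2^-1 * (16 * quad r x *+ \dim z) = 8 * (\dim z)%:R * quad r x.
    by rewrite -mulr_natr; field.
  by rewrite /cquad !rmorphM !rmorph_nat.
by move=> S /(orthonormal_mem rW) SW; rewrite vfield2_cquad_z.
Qed.

Lemma gam_z_cquad_z x : gam t (cquad t) (cquad t) x = 4 * cquad t x.
Proof.
rewrite /gam /cquad /quad sumC mulr_sumr;
  apply: eq_big_seq => S /(orthonormal_mem tz) Sz.
by rewrite vfield_z_cquad_z // (ipC S) !rmorphM rmorph_nat; ring.
Qed.

Lemma gam_z_cquad f x : gam t f (cquad r) x = 0.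
Proof.
rewrite /gam big_seq big1 // => S /(orthonormal_mem tz) Sz.
by rewrite vfield_z_cquad // mulr0.
Qed.

Lemma sum_squares_z_cquad_z x : sum_squares t (cquad t) x = (2 * \dim z)%:R.
Proof.
rewrite /sum_squares (eq_big_seq (fun=> 2)); last first.
  move=> S Sr; rewrite vfield2_z_cquad_z ?(orthonormal_mem tz) //.
  by rewrite (orthonormal_norm tz Sr) mulr1 rmorph_nat.
by rewrite big_const_seq count_predT iter_addr_0 (orthonormal_size tz) natrM
  mulr_natr.
Qed.

Lemma sum_squares_z_cquad x : sum_squares t (cquad r) x = 0.
Proof.
rewrite /sum_squares big_seq big1 // => S /(orthonormal_mem tz) Sz.
have -> : vfield S (cquad r) = fun=> 0; last exact: vfield_cst.
by apply/funext => y; exact: vfield_z_cquad.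
Qed.

End HType.

(** * Powers of the norm function *)

Section PowersOfK.
Context {R : realType} {n : htypeAlg R} (W W' : {vspace n}) (r r' t : seq n).
Notation ip := (@ht_ip R n).
Notation br := (@ht_br R n).
Notation z := (ht_z n).
Hypotheses (WW' : (W + W')%VS = ht_v n) (oW : orthogonal_spaces ip W W')
  (bW : bracket_space br W W' = 0%VS).
Hypotheses (rW : orthonormal_basis ip W r) (rW' : orthonormal_basis ip W' r')
  (tz : orthonormal_basis ip z t).
Variables (U : set n) (k : n -> R).
Hypotheses (oU : open_in U) (k_gt0 : forall x, U x -> 0 < k x)
  (kE : forall x, k x = (quad r x + quad r' x) ^+ 2 + quad t x).

Local Notation cr := (cquad r).
Local Notation cr' := (cquad r').
Local Notation ct := (cquad t).
Local Notation p := ((\dim W)%:R : R[i]).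
Local Notation q := ((\dim z)%:R : R[i]).
Local Notation kc := (fun x => (k x)%:C).
Local Notation Kp s := (fun x => cpow (k x) s).
Local Notation rho := (fun x => cr x + cr' x).

Let sr : smooth_on U cr := smooth_on_cquad r oU.
Let sr' : smooth_on U cr' := smooth_on_cquad r' oU.
Let st : smooth_on U ct := smooth_on_cquad t oU.
Let srho : smooth_on U rho := smooth_onD oU sr sr'.
Let srho2 : smooth_on U (fun x => (cr x + cr' x) ^+ 2) := smooth_onX 2 oU srho.

Let kcE x : (k x)%:C = (cr x + cr' x) ^+ 2 + ct x.
Proof. by rewrite kE /cquad rmorphD rmorphXn /= rmorphD. Qed.

Let kc_fun : kc = fun x => (cr x + cr' x) ^+ 2 + ct x.
Proof. by apply/funext => x; exact: kcE. Qed.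

Lemma smooth_k : smooth (@of_coord R n @^-1` U) (fun a => k (of_coord a)).
Proof.
have sq r0 := @smooth_quad R n U n r0 ip ip oU (@ip_linr _ _) (@ip_linr _ _).
have srr := smoothD oU (sq r) (sq r').
apply: (smooth_eq_on oU _ (smoothD oU (smoothM oU srr srr) (sq t))) => a _.
by rewrite kE expr2.
Qed.

Let sk := smooth_k.

Lemma smooth_Kp s : smooth_on U (Kp s).
Proof. exact: smooth_on_cpow oU sk k_gt0 s. Qed.

Let skc : smooth_on U kc.
Proof. by rewrite kc_fun; exact: smooth_onD. Qed.

Lemma Kp_mulk s x : U x -> cpow (k x) (s - 1) * (k x)%:C = cpow (k x) s.
Proof. by move=> Ux; have := cpowB_nat s 1 (k_gt0 Ux); rewrite expr1. Qed.

Let gam_kc s f x : U x ->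
  gam s f kc x = 2 * (cr x + cr' x) * (gam s f cr x + gam s f cr' x) + gam s f ct x.
Proof.
move=> Ux; rewrite kc_fun (gamDr oU s f srho2 st Ux) (gamXr oU s f 2 srho Ux).
by rewrite (gamDr oU s f sr sr' Ux) expr1.
Qed.

Let gam_r_kc x : U x -> gam r cr kc x = 8 * (cr x + cr' x) * cr x.
Proof.
move=> Ux; rewrite gam_kc // (gam_cquad_same WW' rW) (gam_cquad_other WW' oW rW
  rW').
rewrite (gam_cquad_z WW' oW bW rW tz) ?addr0; ring.
Qed.

(** With a, b, c for |X_1|^2, |X_2|^2, |Z|^2, the part from (a + b)^2 gives 16 a (a + b)^2 and the
    part from c gives 16 a c. The two constants agree, so the sum is a multiple of K. *)
Let gam_kc_kc x : U x -> gam r kc kc x = 16 * cr x * (k x)%:C.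
Proof.
move=> Ux; rewrite gam_kc // (gam_cquad_other WW' oW rW rW') !(gamC r kc)
  gam_r_kc //.
rewrite gam_kc // (gam_cquad_other WW' oW rW rW') gamC (gam_cquad_z WW' oW bW rW
  tz).
rewrite (gam_cquad_zz WW' oW bW rW rW' tz) kcE; ring.
Qed.

Let sum_squares_rho2 x : U x -> sum_squares r (fun y => (cr y + cr' y) ^+ 2) x =
  4 * p * (cr x + cr' x) + 8 * cr x.
Proof.
move=> Ux; rewrite (sum_squaresX oU r 2 srho Ux) (sum_squaresD oU r sr sr' Ux).
rewrite (sum_squares_cquad_same WW' rW) (sum_squares_cquad_other WW' oW rW rW').
rewrite (gamDr oU r _ sr sr' Ux) (gam_cquad_other WW' oW rW rW') addr0 gamC.
rewrite (gamDr oU r _ sr sr' Ux) (gam_cquad_other WW' oW rW rW') addr0.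
rewrite (gam_cquad_same WW' rW) /= natrM; ring.
Qed.

(** The second-order term of the chain rule carries [K_{s-2}] times [gam r kc kc]; the factor K in
    the latter raises it to [K_{s-1}]. *)
Lemma sum_squares_Kp s x : U x -> sum_squares r (Kp s) x =
  4 * s * cpow (k x) (s - 1) * (p * (cr x + cr' x) + 2 * cr x * (2 * s - 1 + q)).
Proof.
move=> Ux; rewrite (sum_squares_cpow oU sk k_gt0 r s Ux) gam_kc_kc //.
have -> : s - 2 = s - 1 - 1 by ring.
rewrite -(Kp_mulk (s - 1) Ux) kc_fun (sum_squaresD oU r srho2 st Ux).
rewrite sum_squares_rho2 // (sum_squares_cquad_z WW' oW bW rW rW' tz) kcE.
by move: (cpow _ _) => X; ring.
Qed.

Let gam_Kp s x : U x -> gam r cr (Kp s) x = 8 * s * (cr x + cr' x) * cr x * cpow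
  (k x) (s - 1).
Proof. by move=> Ux; rewrite (gam_cpow sk k_gt0 r cr s Ux) gam_r_kc //; ring. Qed.

(** The middle summand is K_s times the Euclidean Laplacian of |X_1|^{2m+2} in dimension [p]; the
    last is the cross term of the Leibniz formula. *)
Lemma sum_squares_same_Kp s m x : U x -> sum_squares r (fun y => cr y ^+ m.+1 *
  cpow (k y) s) x =
  cr x ^+ m.+1 * sum_squares r (Kp s) x
  + cpow (k x) s * cr x ^+ m * (2 * m.+1%:R * (p + 2 * m%:R))
  + 16 * m.+1%:R * s * (cr x + cr' x) * cr x ^+ m.+1 * cpow (k x) (s - 1).
Proof.
move=> Ux; rewrite (sum_squaresM oU r (smooth_onX m.+1 oU sr) (smooth_Kp s) Ux).
rewrite (sum_squaresX oU r m.+1 sr Ux) (gamC r _ (Kp s)) (gamXr oU r _ m.+1 sr Ux).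
rewrite (gamC r _ cr) gam_Kp // (sum_squares_cquad_same WW' rW).
rewrite (gam_cquad_same WW' rW) /=.
move: (sum_squares r (Kp s) x) (cpow _ _) (cpow _ _) => A B C.
case: m => [|m]; first by rewrite /= !expr0 expr1 natrM; ring.
by rewrite /= !exprS !natrM -!natr1; ring.
Qed.

Lemma sum_squares_other_Kp s m x : U x -> sum_squares r (fun y => cr' y ^+ m *
  cpow (k y) s) x =
  cr' x ^+ m * sum_squares r (Kp s) x.
Proof.
move=> Ux; rewrite (sum_squaresM oU r (smooth_onX m oU sr') (smooth_Kp s) Ux).
rewrite (sum_squaresX oU r m sr' Ux) (gamC r _ (Kp s)) (gamXr oU r _ m sr' Ux).
rewrite !(gam_cquad_other WW' oW rW rW') (sum_squares_cquad_other WW' oW rW rW').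
by rewrite !mulr0 !addr0 mul0r add0r.
Qed.

Lemma sum_squares_rho_Kp s x : U x -> sum_squares r (fun y => (cr y + cr' y) *
  cpow (k y) s) x =
  (cr x + cr' x) * sum_squares r (Kp s) x + 2 * p * cpow (k x) s + 16 * s * (cr
    x + cr' x) * cr x * cpow (k x) (s - 1).
Proof.
move=> Ux; rewrite (sum_squaresM oU r srho (smooth_Kp s) Ux).
rewrite (sum_squaresD oU r sr sr' Ux) (gamC r _ (Kp s)) (gamDr oU r _ sr sr' Ux).
rewrite (sum_squares_cquad_same WW' rW) (sum_squares_cquad_other WW' oW rW rW').
rewrite (gam_cquad_other WW' oW rW rW') gamC gam_Kp // natrM.
by move: (sum_squares r (Kp s) x) (cpow _ _) (cpow _ _) => A B C; ring.
Qed.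

End PowersOfK.

(** * The recursion for generic s *)

Lemma linear_neq0 (K : fieldType) (a b s : K) : a != 0 -> s != - b / a -> a * s
  + b != 0.
Proof.
move=> a0; apply: contra => /eqP abs0; apply/eqP.
by apply: (mulIf a0); rewrite mulrVK ?unitfE // mulrC; apply/eqP;
  rewrite -addr_eq0 abs0.
Qed.

Section Main.
Context {R : realType} {n : htypeAlg R} (v1 v2 : {vspace n}) (S1 S2 T : seq n).
Notation ip := (@ht_ip R n).
Notation br := (@ht_br R n).
Notation z := (ht_z n).
Hypotheses (hsub : htype_subalgebra v1 v2)
  (hS1 : orthonormal_basis ip v1 S1) (hS2 : orthonormal_basis ip v2 S2)
  (hT : orthonormal_basis ip z T).

Let v12 : (v1 + v2)%VS = ht_v n. Proof. by case: hsub. Qed.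
Let v21 : (v2 + v1)%VS = ht_v n. Proof. by rewrite addvC v12. Qed.
Let o12 : orthogonal_spaces ip v1 v2. Proof. by case: hsub. Qed.
Let o21 : orthogonal_spaces ip v2 v1.
Proof. by move=> x y xv yv; rewrite ipC o12. Qed.
Let b12 : bracket_space br v1 v2 = 0%VS. Proof. by case: hsub. Qed.
Let br12 x y : x \in v1 -> y \in v2 -> br x y = 0.
Proof.
move=> xv yv; apply/eqP; rewrite -memv0 -b12.
by apply: mem_bracket_space => //; exact: ht_brP.
Qed.
Let b21 : bracket_space br v2 v1 = 0%VS.
Proof.
apply/eqP; rewrite -subv0; apply/span_subvP => w /allpairsP[[x y] /= [xv yv ->]].
by rewrite (br_anti (ht_brP n)) br12 ?oppr0 ?mem0v ?vbasis_mem.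
Qed.

(** The function [Kfun] in orthonormal bases, see [Kfun_knorm]; in this form its smoothness is
    immediate. *)
Definition knorm x : R := (quad S1 x + quad S2 x) ^+ 2 + quad T x.

Let kE12 x : knorm x = (quad S1 x + quad S2 x) ^+ 2 + quad T x. Proof. by []. Qed.
Let kE21 x : knorm x = (quad S2 x + quad S1 x) ^+ 2 + quad T x.
Proof. by rewrite addrC kE12 addrC (addrC (quad S2 x)). Qed.

Definition off0 : set n := [set x | x <> 0].

Lemma open_off0 : open_in off0.
Proof.
rewrite /open_in (_ : _ @^-1` _ = ~` [set 0]).
  by apply: closed_openC; apply: accessible_closed_set1;
    apply: hausdorff_accessible; exact: norm_hausdorff.
apply/seteqP; split => a /= aP; first by move=> a0; apply: aP;
  rewrite a0 (lin0 of_coord_linear).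
by move=> a0; apply: aP; rewrite -(of_coordK a) a0 (lin0 to_coord_linear).
Qed.

Lemma knorm_gt0 x : off0 x -> 0 < knorm x.
Proof.
move=> x0; rewrite lt_neqAle addr_ge0 ?sqr_ge0 ?quad_ge0 // andbT eq_sym.
apply/eqP => k0; apply: x0; move: k0.
have [x1 [x2 [x3 [x1v x2v x3z xE]]]] := htype_dec v12 x.
have [q1 q2 q3] := quad_dec v12 o12 hS1 hS2 hT x1v x2v x3z.
rewrite /knorm xE q1 q2 q3 => /eqP.
rewrite paddr_eq0 ?sqr_ge0 ?ip_ge0 // sqrf_eq0 paddr_eq0 ?ip_ge0 //.
move=> /andP[/andP[/eqP/ip_eq0 -> /eqP/ip_eq0 ->] /eqP/ip_eq0 ->].
by rewrite !addr0.
Qed.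

Local Notation U := off0.
Local Notation oU := open_off0.
Local Notation fa := (cquad S1).
Local Notation fb := (cquad S2).
Local Notation Kp s := (fun x => cpow (knorm x) s).
Local Notation D1 := (sum_squares S1 : oper n).
Local Notation D2 := (sum_squares S2 : oper n).
Local Notation Bx := (sum_squares T : oper n).
Local Notation p1 := ((\dim v1)%:R : R[i]).
Local Notation p2 := ((\dim v2)%:R : R[i]).
Local Notation q := ((\dim z)%:R : R[i]).

Let sK : smooth (@of_coord R n @^-1` U) (fun a => knorm (of_coord a)).
Proof. exact: (smooth_k oU kE12). Qed.

Let sKp s : smooth_on U (Kp s).
Proof. exact: (smooth_on_cpow oU sK knorm_gt0). Qed.

Let sfa : smooth_on U fa := smooth_on_cquad S1 oU.
Let sfb : smooth_on U fb := smooth_on_cquad S2 oU.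

Let l1 : left_invariant_diffop D1 := lido_sum_squares S1.
Let l2 : left_invariant_diffop D2 := lido_sum_squares S2.
Let lB : left_invariant_diffop Bx := lido_sum_squares T.

Lemma commute_21 : oper_commute D2 D1.
Proof.
apply: sum_squares_commute => S S' /(orthonormal_mem hS2) Sv /(orthonormal_mem
  hS1) S'v.
by rewrite (br_anti (ht_brP n)) br12 // oppr0.
Qed.

Lemma commute_B (r : seq n) : oper_commute Bx (sum_squares r).
Proof.
by apply: sum_squares_commute => S S' /(orthonormal_mem hT) Sz _; exact: br_central.
Qed.

Let D1_Kp s x : U x -> D1 (Kp s) x =
  4 * s * cpow (knorm x) (s - 1) * (p1 * (fa x + fb x) + 2 * fa x * (2 * s - 1 +
    q)).
Proof. exact: (sum_squares_Kp v12 o12 b12 hS1 hS2 hT oU knorm_gt0 kE12). Qed.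

Let D2_Kp s x : U x -> D2 (Kp s) x =
  4 * s * cpow (knorm x) (s - 1) * (p2 * (fa x + fb x) + 2 * fb x * (2 * s - 1 +
    q)).
Proof.
by move=> Ux; rewrite (addrC (fa x));
  exact: (sum_squares_Kp v21 o21 b21 hS2 hS1 hT oU knorm_gt0 kE21).
Qed.

Let D1_fbKp s m x : U x -> D1 (fun y => fb y ^+ m * cpow (knorm y) s) x =
  fb x ^+ m * D1 (Kp s) x.
Proof. exact: (sum_squares_other_Kp v12 o12 hS1 hS2 oU knorm_gt0 kE12). Qed.

Let D2_fbKp s m x : U x -> D2 (fun y => fb y ^+ m.+1 * cpow (knorm y) s) x =
  fb x ^+ m.+1 * D2 (Kp s) x
  + cpow (knorm x) s * fb x ^+ m * (2 * m.+1%:R * (p2 + 2 * m%:R))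
  + 16 * m.+1%:R * s * (fa x + fb x) * fb x ^+ m.+1 * cpow (knorm x) (s - 1).
Proof.
by move=> Ux; rewrite (addrC (fa x));
  exact: (sum_squares_same_Kp v21 o21 b21 hS2 hS1 hT oU knorm_gt0 kE21).
Qed.

Let D1_rhoKp s x : U x -> D1 (fun y => (fa y + fb y) * cpow (knorm y) s) x =
  (fa x + fb x) * D1 (Kp s) x + 2 * p1 * cpow (knorm x) s
  + 16 * s * (fa x + fb x) * fa x * cpow (knorm x) (s - 1).
Proof. exact: (sum_squares_rho_Kp v12 o12 b12 hS1 hS2 hT oU knorm_gt0 kE12). Qed.

Let D2_rhoKp s x : U x -> D2 (fun y => (fa y + fb y) * cpow (knorm y) s) x =
  (fa x + fb x) * D2 (Kp s) x + 2 * p2 * cpow (knorm x) s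
  + 16 * s * (fa x + fb x) * fb x * cpow (knorm x) (s - 1).
Proof.
move=> Ux; rewrite (addrC (fa x)).
have -> : (fun y => (fa y + fb y) * cpow (knorm y) s) = (fun y => (fb y + fa y)
  * cpow (knorm y) s).
  by apply/funext => y; rewrite (addrC (fa y)).
exact: (sum_squares_rho_Kp v21 o21 b21 hS2 hS1 hT oU knorm_gt0 kE21).
Qed.

Let kcE x : (knorm x)%:C = (fa x + fb x) ^+ 2 + cquad T x.
Proof. by rewrite /knorm /cquad rmorphD rmorphXn /= rmorphD. Qed.

(** For the central fields the carre du champ of K is 4|Z|^2 = 4(K - |X|^4), not a multiple of K, so
    a [K_{s-2}] term survives. *)
Lemma Box_Kp s x : U x -> Bx (Kp s) x =
  2 * s * (q + 2 * s - 2) * cpow (knorm x) (s - 1)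
  - 4 * s * (s - 1) * (fa x + fb x) ^+ 2 * cpow (knorm x) (s - 2).
Proof.
move=> Ux; rewrite (sum_squares_cpow oU sK knorm_gt0 T s Ux).
have srho := smooth_onD oU sfa sfb.
have srho2 := smooth_onX 2 oU srho.
have st := smooth_on_cquad T oU.
have gB f y : U y -> gam T f (fun y => fa y + fb y) y = 0.
  move=> Uy; rewrite (gamDr oU T f sfa sfb Uy) (gam_z_cquad v12 hS1 hT).
  by rewrite (gam_z_cquad v21 hS2 hT) addr0.
have gBK f y : U y -> gam T f (fun y => (knorm y)%:C) y = gam T f (cquad T) y.
  move=> Uy; have -> : (fun y => (knorm y)%:C) = (fun y => (fa y + fb y) ^+ 2 +
    cquad T y).
    by apply/funext => w; exact: kcE.
  by rewrite (gamDr oU T f srho2 st Uy) (gamXr oU T f 2 srho Uy) gB // mulr0 add0r.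
have BK : Bx (fun y => (knorm y)%:C) x = 2 * q.
  have -> : (fun y => (knorm y)%:C) = (fun y => (fa y + fb y) ^+ 2 + cquad T y).
    by apply/funext => w; exact: kcE.
  rewrite (sum_squaresD oU T srho2 st Ux) (sum_squaresX oU T 2 srho Ux).
  rewrite (sum_squaresD oU T sfa sfb Ux) gB // (sum_squares_z_cquad v12 hS1 hT).
  by rewrite (sum_squares_z_cquad v21 hS2 hT) (sum_squares_z_cquad_z hT)
    !(addr0, mulr0) add0r (natrM _ 2 (\dim z)).
rewrite gBK // gamC gBK // (gam_z_cquad_z hT) BK.
have -> : cquad T x = (knorm x)%:C - (fa x + fb x) ^+ 2 by rewrite kcE addrAC
  subrr add0r.
have <- : cpow (knorm x) (s - 2) * (knorm x)%:C = cpow (knorm x) (s - 1).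
  have -> : s - 2 = s - 1 - 1 by ring.
  exact: (Kp_mulk knorm_gt0).
move: (cpow _ _) => X; ring.
Qed.

Local Notation rho := ((\dim v1 + \dim v2 + 2 * \dim z)%:R / 2 : R[i]).
Let rhoE : 2 * rho = p1 + p2 + 2 * q.
Proof.
rewrite (natrD _ (\dim v1 + \dim v2)%N) (natrD _ (\dim v1)) (natrM _ 2).
by rewrite mulrC mulfVK // pnatr_eq0.
Qed.

Local Notation Delta := (oper_add D1 D2).
Let lD : left_invariant_diffop Delta := lido_add l1 l2.

(** The separate |X_1|^2 and |X_2|^2 terms of the two halves have the same coefficient, so they add
    up to a multiple of |X|^2; the total factor is p1 + p2 + 2(2s - 1 + q) = 4s + 2rho - 2. *)
Lemma Delta_Kp s x : U x -> Delta (Kp s) x =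
  4 * s * (4 * s + 2 * rho - 2) * ((fa x + fb x) * cpow (knorm x) (s - 1)).
Proof.
by move=> Ux; rewrite /oper_add D1_Kp // D2_Kp // rhoE; move: (cpow _ _) => X; ring.
Qed.

(** With M = 4s + 2rho - 2, Delta^2 K_s contains 16 s (s-1) M^2 |X|^4 K_{s-2}, and the factor 4M^2
    of [Bx] is the one that cancels it. The remaining coefficient 8sM (p1 + p2 + M (2s + q - 2))
    factors as stated. *)
Lemma Delta2_Box_Kp s x : U x ->
  oper_add (oper_exp Delta 2) (oper_scale (4 * (4 * s + 2 * rho - 2) ^+ 2) Bx)
    (Kp s) x =
  2 * (4 * s * (4 * s + 2 * rho - 2)) * (2 * s + q - 1) * (4 * s + 2 * rho - 4)
    * cpow (knorm x) (s - 1).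
Proof.
move=> Ux; rewrite {1}/oper_add /oper_scale.
have -> : oper_exp Delta 2 (Kp s) x = Delta (Delta (Kp s)) x by [].
rewrite (lido_local lD oU (Delta_Kp s) Ux).
rewrite (lidoZ lD _ oU (smooth_onM oU (smooth_onD oU sfa sfb) (sKp (s - 1))) Ux).
rewrite {1}/oper_add D1_rhoKp // D2_rhoKp // D1_Kp // D2_Kp // Box_Kp // rhoE.
have -> : s - 1 - 1 = s - 2 by ring.
by move: (cpow _ _) (cpow _ _) => X Y; ring.
Qed.

Local Notation Dk := (Dop D1 D2 Bx (\dim v1) (\dim v2) (\dim z)).

Let lDk k s : left_invariant_diffop (Dk k s).
Proof. exact: lido_Dop. Qed.

(** The finite set [E], the same for all [x], collects the zeros of the denominators met in
    unfolding the recursion, where the values of [Dop] are junk. *)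
Definition generic_Dk k := exists E : seq R[i],
  forall s, s \notin E -> forall x, U x ->
  Dk k s (Kp s) x = fb x ^+ k * cpow (knorm x) (s - k%:R).

Lemma generic_D0 : generic_Dk 0.
Proof. by exists [::] => s _ x _; rewrite mul1r subr0. Qed.

Let four_neq0 : 4 != 0 :> R[i]. Proof. by rewrite pnatr_eq0. Qed.
Let two_neq0 : 2 != 0 :> R[i]. Proof. by rewrite pnatr_eq0. Qed.

Lemma generic_D1 : generic_Dk 1.
Proof.
exists [:: 0; - (2 * rho - 2) / 4; - (q - 1) / 2] => s.
rewrite !inE !negb_or => /and3P[s0 M0 N0] x Ux.
have M1 : 4 * s + 2 * rho - 2 != 0 by rewrite -addrA; exact: linear_neq0.
have N1 : 2 * s + q - 1 != 0 by rewrite -addrA; exact: linear_neq0.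
rewrite /= /oper_scale /oper_add D1_Kp // D2_Kp //.
move: M1; rewrite rhoE expr1 => M1.
move: (cpow _ _) => X; field.
by rewrite s0 M1 N1.
Qed.

(** Let m = k+1 and M = 4s + 2rho - 2. On |X_2|^{2m} K_{s-m}, the coefficient of |X|^2 |X_2|^{2m}
    K_{s-m-1} is 4(s-m)(4m + p2) for Delta_2 and 4(s-m)M for Delta, so M Delta_2 - (4m + p2) Delta
    removes it. The |X_2|^{2m-2} K_{s-m} term is left with 2m(2m + p2 - 2)(M - 4m - p2), where M -
    4m - p2 = 4s + 2rho_1 - 4m - 2; the second term of the recursion cancels it. What stays is
    8(s-m) M (2s + q - 2m - 1) |X_2|^{2m+2} K_{s-m-1}, whence the prefactor. *)
Lemma generic_DS k : generic_Dk k -> generic_Dk k.+1 -> generic_Dk k.+2.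
Proof.
move=> [E0 HE0] [E1 HE1].
(* The listed values are the zeros of the linear factors of the denominators at this stage. [E0] is
   shifted by 1 because the recursion calls [Dk k] at [s - 1]. *)
exists ([:: k.+1%:R; - (2 * rho - 2) / 4; - (q - 2 * k.+1%:R - 1) / 2; 0;
   - (q - 1) / 2; - (2 * rho - 4) / 4] ++ E1 ++ [seq e + 1 | e <- E0]) => s.
rewrite !mem_cat !negb_or => /and3P[].
move=> /and5P[sk M0 Nk0 s0 /and3P[N0 L0 _]] sE1 sE0 x Ux.
have s1E0 : s - 1 \notin E0.
  by apply: contra sE0 => s1; apply/mapP; exists (s - 1) => //; rewrite subrK.
have M1 : 4 * s + 2 * rho - 2 != 0 by rewrite -addrA; exact: linear_neq0.
have L1 : 4 * s + 2 * rho - 4 != 0 by rewrite -addrA; exact: linear_neq0.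
have N1 : 2 * s + q - 1 != 0 by rewrite -addrA; exact: linear_neq0.
have Nk1 : 2 * s + q - 2 * k.+1%:R - 1 != 0.
  by have := linear_neq0 two_neq0 Nk0; rewrite !addrA.
have sk1 : s - k.+1%:R != 0 by rewrite subr_eq0.
set M := 4 * s + 2 * rho - 2 in M1.
pose Q := oper_add (oper_exp Delta 2) (oper_scale (4 * M ^+ 2) Bx).
have lQ : left_invariant_diffop Q.
  by apply: lido_add; [exact: lido_exp|exact: lido_scale].
have QE : Q (Dk k (s - 1) (Kp s)) x =
    2 * (4 * s * M) * (2 * s + q - 1) * (4 * s + 2 * rho - 4)
    * (fb x ^+ k * cpow (knorm x) (s - k.+1%:R)).
  have QD : oper_commute Q (Dk k (s - 1)).
    have c21 := commute_21; have cB1 := commute_B S1; have cB2 := commute_B S2.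
    have c11 : oper_commute D1 D1 := oper_eq_refl _.
    have c22 : oper_commute D2 D2 := oper_eq_refl _.
    have cBB : oper_commute Bx Bx := oper_eq_refl _.
    have lX := lido_exp 2 lD.
    have lS := lido_scale (4 * M ^+ 2) lB.
    have QC A : left_invariant_diffop A -> oper_commute A D1 -> oper_commute A D2 ->
        oper_commute A Bx -> oper_commute Q A.
      move=> lA A1 A2 AB; apply: oper_commute_sym.
      exact: (oper_commuteD lA lX lS (oper_commuteX 2 lA lD (oper_commuteD lA l1
        l2 A1 A2))
        (oper_commuteZ _ lA lB AB)).
    have Q1 := QC _ l1 c11 (oper_commute_sym c21) (oper_commute_sym cB1).
    have Q2 := QC _ l2 c21 c22 (oper_commute_sym cB2).
    have QB := QC _ lB cB1 cB2 cBB.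
    exact: (Dop_commute l1 l2 lB _ _ _ _ _ lQ Q1 Q2 QB).
  have -> : Q (Dk k (s - 1) (Kp s)) x = Dk k (s - 1) (Q (Kp s)) x := QD U _ oU
    (sKp s) x Ux.
  rewrite (lido_local (lDk k (s - 1)) oU (Delta2_Box_Kp s) Ux).
  rewrite (lidoZ (lDk k (s - 1)) _ oU (sKp (s - 1)) Ux) HE0 //.
  by have -> : s - 1 - k%:R = s - k.+1%:R by rewrite -[k.+1%:R]natr1; ring.
have D1E : D1 (Dk k.+1 s (Kp s)) x = _ :=
  etrans (lido_local l1 oU (HE1 s sE1) Ux) (D1_fbKp (s - k.+1%:R) k.+1 Ux).
have D2E : D2 (Dk k.+1 s (Kp s)) x = _ :=
  etrans (lido_local l2 oU (HE1 s sE1) Ux) (D2_fbKp (s - k.+1%:R) k Ux).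
have -> : Dk k.+2 s (Kp s) x =
  1 / (8 * (s - k.+1%:R) * M * (2 * s + q - 2 * k.+1%:R - 1)) *
   ((M * D2 (Dk k.+1 s (Kp s)) x
     + - (4 * k.+1%:R + p2) * (D1 (Dk k.+1 s (Kp s)) x + D2 (Dk k.+1 s (Kp s)) x))
    + - ((2 * k.+1%:R * (2 * k.+1%:R + p2 - 2) *
          (4 * s + 2 * ((\dim v1 + 2 * \dim z)%:R / 2) - 4 * k.+1%:R - 2)) /
         (2 * (4 * s * M) * (2 * s + q - 1) * (4 * s + 2 * rho - 4)))
      * Q (Dk k (s - 1) (Kp s)) x) by [].
rewrite QE D1E D2E D1_Kp // D2_Kp //.
have r1E : 2 * ((\dim v1 + 2 * \dim z)%:R / 2) = p1 + 2 * q.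
  by rewrite (natrD _ (\dim v1)) (natrM _ 2) mulrC mulfVK.
have -> : s - k.+1%:R - 1 = s - k.+2%:R by rewrite -[k.+2%:R]natr1; ring.
move: M1 L1; rewrite /M rhoE r1E => M1 L1.
move: N1 Nk1 sk1; rewrite -[k.+1%:R]natr1.
move: (cpow _ _) (cpow _ (s - k.+2%:R)) => X Y N1 Nk1 sk1.
rewrite !exprS; move: (fb x ^+ k) => F.
field.
by rewrite s0 M1 L1 N1 Nk1 sk1.
Qed.

Lemma generic_D k : generic_Dk k.
Proof.
suff [] : generic_Dk k /\ generic_Dk k.+1 by [].
elim: k => [|k [IH0 IH1]]; first by split; [exact: generic_D0|exact: generic_D1].
by split => //; exact: generic_DS.
Qed.

End Main.

(** * Specialization at a regular value *)

Section ExpPoly.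
Context {R : realType} {n : htypeAlg R} (U : set n) (k : n -> R).
Hypotheses (oU : open_in U)
  (sk : smooth (@of_coord R n @^-1` U) (fun a => k (of_coord a)))
  (k_gt0 : forall x, U x -> 0 < k x).
Implicit Types (F G : R[i] -> n -> R[i]).

(* Families of the form [k ^ s] times a polynomial in [s] with smooth
   coefficients. *)
Inductive exp_poly : (R[i] -> n -> R[i]) -> Prop :=
| ep_base g : smooth_on U g -> exp_poly (fun s x => cpow (k x) s * g x)
| ep_add F G : exp_poly F -> exp_poly G -> exp_poly (fun s x => F s x + G s x)
| ep_param F : exp_poly F -> exp_poly (fun s x => s * F s x)
| ep_scale c F : exp_poly F -> exp_poly (fun s x => c * F s x)
| ep_eq_on F G : exp_poly F -> (forall s x, U x -> F s x = G s x) -> exp_poly G.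

Lemma exp_poly_smooth F : exp_poly F -> forall s, smooth_on U (F s).
Proof.
elim=> {F} [g sg|F G _ IHF _ IHG|F _ IHF|c F _ IHF|F G _ IHF FG] s.
- by apply: smooth_onM => //; exact: smooth_on_cpow.
- exact: smooth_onD.
- exact: smooth_onZ.
- exact: smooth_onZ.
- by apply: smooth_on_eq (IHF s) => // x; exact: FG.
Qed.

(** On a generator, [S (k^s g) = k^s (s k^{-1} (S k) g + S g)]: the inverse of [k] is kept among the
    smooth coefficients, so the exponent stays [s] and the rest is polynomial in [s]. *)
Lemma exp_poly_vfield S F : exp_poly F -> exp_poly (fun s => vfield S (F s)).
Proof.
elim=> {F} [g sg|F G hF IHF hG IHG|F hF IHF|c F hF IHF|F G hF IHF FG].
- have skc : smooth_on U (fun x => (k x)%:C) by exact: smooth_on_real.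
  have sm1 : smooth_on U (fun x => cpow (k x) (- 1)) := smooth_on_cpow oU sk
    k_gt0 _.
  apply: ep_eq_on (ep_add (ep_param (ep_base (smooth_onM oU sm1
    (smooth_onM oU (smooth_on_vfield S oU skc) sg))))
    (ep_base (smooth_on_vfield S oU sg))) _ => s x Ux.
  rewrite (vfieldM S oU (smooth_on_cpow oU sk k_gt0 s) sg Ux).
  rewrite (vfield_cpow sk k_gt0 S s Ux) cpowD.
  by move: (vfield S _ x) (vfield S _ x) => a b; ring.
- apply: ep_eq_on (ep_add IHF IHG) _ => s x Ux.
  by rewrite (vfieldD S oU (exp_poly_smooth hF s) (exp_poly_smooth hG s) Ux).
- apply: ep_eq_on (ep_param IHF) _ => s x Ux.
  by rewrite (vfieldZ S s oU (exp_poly_smooth hF s) Ux).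
- apply: ep_eq_on (ep_scale c IHF) _ => s x Ux.
  by rewrite (vfieldZ S c oU (exp_poly_smooth hF s) Ux).
- by apply: ep_eq_on IHF _ => s x; exact: (vfield_local S oU (FG s)).
Qed.

Lemma exp_poly_lido A : left_invariant_diffop A ->
  forall F, exp_poly F -> exp_poly (fun s => A (F s)).
Proof.
elim=> {A} [|S|A B _ IHA _ IHB|c A _ IHA|A B _ IHA _ IHB] F hF.
- exact: hF.
- exact: exp_poly_vfield.
- by apply: ep_add; [exact: IHA|exact: IHB].
- by apply: ep_scale; exact: IHA.
- exact: IHA (IHB _ hF).
Qed.

Lemma exp_poly_horner F x : exp_poly F -> U x ->
  exists p : {poly R[i]}, forall s, F s x = cpow (k x) s * p.[s].
Proof.
move=> hF Ux; elim: hF => {F} [g sg|F G _ [p pE] _ [p' pE']|F _ [p pE]|c F _ [p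
  pE]|F G _ [p pE] FG].
- by exists (g x)%:P => s; rewrite hornerC.
- by exists (p + p') => s; rewrite pE pE' hornerD mulrDr.
- by exists ('X * p) => s; rewrite pE hornerM hornerX mulrCA.
- by exists (c *: p) => s; rewrite pE hornerZ mulrCA.
- by exists p => s; rewrite -FG // pE.
Qed.

End ExpPoly.

(** * Components given by projections and by orthonormal bases *)

Section Projections.
Context {R : realType} {n : htypeAlg R}.
Notation ip := (@ht_ip R n).

(** Orthogonality makes the intersection trivial. The two projections of [w] then add up to [w], and
    the one to [W] is already [w], so the one to [U] is zero. *)
Lemma orthogonal_daddv_pi (U W : {vspace n}) u w : orthogonal_spaces ip U W ->
  u \in U -> w \in W -> daddv_pi U W (u + w) = u.
Proof.
move=> oUW uU wW.
have UW0 : (U :&: W = 0)%VS.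
  apply/eqP; rewrite -subv0; apply/subvP => x; rewrite memv_cap => /andP[xU xW].
  by rewrite memv0; apply/eqP; apply: ip_eq0; exact: oUW.
have WU0 : (W :&: U = 0)%VS by rewrite capvC.
rewrite linearD /= daddv_pi_id //.
have := @daddv_pi_add _ _ U W w UW0; rewrite (daddv_pi_id WU0 wW).
move=> /(_ (subvP (addvSr _ _) _ wW)) /eqP.
by rewrite -subr_eq0 addrK => /eqP ->; rewrite addr0.
Qed.

Context (v1 v2 : {vspace n}) (S1 S2 T : seq n).
Hypotheses (hsub : htype_subalgebra v1 v2)
  (hS1 : orthonormal_basis ip v1 S1) (hS2 : orthonormal_basis ip v2 S2)
  (hT : orthonormal_basis ip (ht_z n) T).

Lemma Kfun_knorm x : Kfun x = knorm S1 S2 T x.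
Proof.
have [v12 o12 _ _] := hsub.
have [x1 [x2 [x3 [x1v x2v x3z xE]]]] := htype_dec v12 x.
have [q1 q2 q3] := quad_dec v12 o12 hS1 hS2 hT x1v x2v x3z.
have xv : x1 + x2 \in ht_v n.
  by rewrite -v12; apply: memv_add.
rewrite /knorm xE q1 q2 q3 /Kfun (orthogonal_daddv_pi (@ht_orth _ n)) //.
rewrite (addrC (x1 + x2)) orthogonal_daddv_pi //; last first.
  by move=> u w uz wv; rewrite ipC; exact: ht_orth.
rewrite -[4%N]/(2 * 2)%N exprM !sqr_ip_norm ipDl !ipDr (o12 _ _ x1v x2v).
by rewrite (ipC x2 x1) (o12 _ _ x1v x2v) addr0 add0r.
Qed.

Lemma norm_proj2 x : ip_norm ip (proj2 v1 v2 x) ^+ 2 = quad S2 x.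
Proof.
have [v12 o12 _ _] := hsub.
have [x1 [x2 [x3 [x1v x2v x3z xE]]]] := htype_dec v12 x.
have [q1 q2 q3] := quad_dec v12 o12 hS1 hS2 hT x1v x2v x3z.
rewrite sqr_ip_norm xE q2 /proj2 (addrC x1) -addrA orthogonal_daddv_pi //.
  move=> u w uv /memv_addP[w1 w1v [w3 w3z ->]].
  rewrite ipDr (ipC u w1) (o12 _ _ w1v uv) add0r; apply: ht_orth => //.
  by rewrite -v12; apply: (subvP (addvSr _ _)).
exact: memv_add.
Qed.

End Projections.

Theorem proposition3p5 (R : realType) (n : htypeAlg R) (v1 v2 : {vspace n})
    (hsub : htype_subalgebra v1 v2)
    (S1 S2 T : seq n)
    (hS1 : orthonormal_basis (@ht_ip R n) v1 S1)
    (hS2 : orthonormal_basis (@ht_ip R n) v2 S2)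
    (hT : orthonormal_basis (@ht_ip R n) (ht_z n) T)
    (k : nat) (s : R[i]) (Dsk : oper n)
    (hD : regular_value
            (Dop (sum_squares S1) (sum_squares S2) (sum_squares T)
                 (\dim v1) (\dim v2) (\dim (ht_z n)) k)
            s Dsk) :
  (exists C : nat -> nat -> nat -> R[i],
     oper_eq Dsk
       (fun f x =>
          \sum_(i < k.+1) \sum_(j < k.+1) \sum_(l < k.+1 | (i + j + 2 * l == k)%N)
             C i j l * oper_comp (oper_exp (sum_squares S1) i)
                         (oper_comp (oper_exp (sum_squares S2) j)
                                    (oper_exp (sum_squares T) l)) f x))
  /\
  (forall x : n, x <> 0 ->
     Dsk (Kpow s) x
     = (ip_norm (@ht_ip R n) (proj2 v1 v2 x) ^+ (2 * k))%:C
       * Kpow (s - k%:R) x).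
Proof.
have l1 := lido_sum_squares S1; have l2 := lido_sum_squares S2.
have lB := lido_sum_squares T.
have c21 := commute_21 hsub hS1 hS2.
have cB1 := commute_B hT S1; have cB2 := commute_B hT S2.
split.
  (* The sum required is a [form] up to conversion. *)
  apply: (homogeneous_regular_value _ hD) => s'.
  exact: (homogeneous_Dop l1 l2 lB c21 cB1 cB2).
move=> x x0; have [d [P [E [ds0 lP FP LP]]]] := hD.
have [E' genE] := generic_D hsub hS1 hS2 hT k.
have [v12 o12 b12 _] := hsub.
pose K : n -> R := knorm S1 S2 T.
have K0 : forall y, off0 y -> 0 < K y := knorm_gt0 hsub hS1 hS2 hT.
have sK : smooth (@of_coord R n @^-1` off0) (fun a => K (of_coord a)).
  exact: (smooth_k open_off0 (fun=> erefl)).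
have KpowE s' : Kpow s' = fun y : n => cpow (K y) s'.
  by apply/funext => y; rewrite /Kpow (Kfun_knorm hsub hS1 hS2 hT).
rewrite exprM (norm_proj2 hsub hS1 hS2 hT) rmorphXn /= -/(cquad S2 x) !KpowE.
have sKp s' : smooth_on off0 (fun y => cpow (K y) s').
  exact: smooth_on_cpow open_off0 sK K0 s'.
have [p pE] : exists p : {poly R[i]}, forall t,
    oper_poly P t (fun y => cpow (K y) t) x = cpow (K x) t * p.[t].
  suff hP : forall m, (m <= size P)%N -> exists p : {poly R[i]}, forall t,
      \sum_(i < m) t ^+ i * nth (@oper_id _ n) P i (fun y => cpow (K y) t) x
      = cpow (K x) t * p.[t] by exact: hP.
  elim=> [|m IHm] mP.
    by exists 0 => t; rewrite big_ord0 horner0 mulr0.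
  have [p pE] := IHm (ltnW mP).
  have base : exp_poly off0 K (fun t y => cpow (K y) t).
    apply: ep_eq_on (ep_base K (smooth_on_cst 1 open_off0)) _ => t y _.
    by rewrite mulr1.
  have [p' pE'] := exp_poly_horner (exp_poly_lido open_off0 sK K0 (lP m mP)
    base) x0.
  exists (p + 'X^m * p') => t;
    rewrite big_ord_recr /= pE pE' hornerD hornerM hornerXn.
  by rewrite mulrDr mulrCA.
(* At the fixed point [x] the factor |X_2|^{2k} K^{-k} does not depend on [t]. Dividing the identity
   known off [E ++ E'] by the nonzero [K^t] leaves two polynomials in [t], whose equality may then
   be evaluated at [s], even if [s] is exceptional. *)
have pd : p = d * (cquad S2 x ^+ k * cpow (K x) (- k%:R))%:P.
  apply: (@poly_eq_cofinite _ _ _ (E ++ E')) => t.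
  rewrite mem_cat negb_or => /andP[tE tE'].
  apply: (mulfI (cpow_neq0 (K x) t)); rewrite -pE.
  rewrite -(FP t tE _ _ open_off0 (sKp t) x x0) /oper_scale genE //.
  by rewrite hornerM hornerC cpowD; ring.
rewrite (LP _ _ open_off0 (sKp s) x x0) /oper_scale pE pd hornerM hornerC cpowD.
by field.
Qed.
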